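(* Let $n,k$ be positive integers with $2k<n$. The explicit map $\Theta$ described in the context is a (well-defined) bijection from the set of $k$-triangulations of the convex $n$-gon to the set of $k$-fans of Dyck paths of length $2(n-2k)$.
   Context: **Objects.** A $k$-triangulation of a convex $n$-gon (vertices labelled $1,\dots,n$ cyclically) is a maximal collection of diagonals such that no $k+1$ of them mutually cross. A Dyck path of length $2\ell$ is a lattice path from $(0,0)$ to $(\ell,\ell)$ with unit north and east steps staying weakly above the line $y=x$. A $k$-fan of Dyck paths of length $2\ell$ is a collection of $k$ such paths that do not cross (they may share edges), i.e. a weakly nested family $D_1,\dots,D_k$ with $D_1$ uppermost and $D_k$ lowermost. **Conventions.** Boxes are $(\text{row},\text{column})$, rows numbered from top to bottom and columns from left to right. The staircase $(n-1,\dots,2,1)$ is the set of boxes $(r,c)$ with $r,c\ge 1$, $r+c\le n$. Put $m=n-2k$ and $\mu=(m-1,m-2,\dots,1)$. **The map $\Theta$.** Let $T$ be a $k$-triangulation. 1. *Filling.* Identify the pair $\{i,j\}$, $1\le i<j\le n$, with the box $(n+1-j,\,i)$ of the staircase. Let $F$ be the set of boxes whose pair is a side of the $n$-gon or a diagonal of $T$. Let $D$ be the complement of $F$ in the staircase. 2. *Reading biword.* List the boxes $(r,c)$ of $D$ row by row from top to bottom, and within each row from right to left, and write the column $\binom{r}{r+c-1}$ for each. This gives $t=\binom{a_1\cdots a_\ell}{b_1\cdots b_\ell}$. 3. *Column Edelman--Greene insertion.* Insert $b_1,b_2,\dots,b_\ell$ successively into an initially empty tableau. To insert $x$ into a column (starting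 with the first column): if no entry of the column is larger than $x$, put $x$ at the bottom of the column and stop. Otherwise let $y$ be the smallest entry larger than $x$. If $y=x+1$ and $x$ is already in the column, leave the column unchanged and insert $x+1$ into the next column; otherwise replace $y$ by $x$ and insert $y$ into the next column. When the insertion of $b_s$ creates a new box, record $a_s$ in the same position of the recording tableau. The resulting recording tableau $Q$ has shape $\mu$ and is a $k$-flagged tableau: rows weakly increasing, columns strictly increasing, positive integer entries, and the entries in row $i$ are $\le i+k$. 4. *Reverse plane partition.* Let $R(i,j)=Q(i,j)-i$ for $(i,j)\in\mu$; the entries of $R$ lie in $\{0,\dots,k\}$ and increase weakly along rows and down columns. 5. *Paths.* Place $\mu$ in the plane so that its box $(i,j)$ is the unit square $[j-1,j]\times[m-i,m-i+1]$. For $s=1,\dots,k$ let $D_s$ be the lattice path from $(0,0)$ to $(m,m)$ starting with a north step from $(0,0)$ to $(0,1)$, ending with an east step from $(m-1,m)$ to $(m,m)$, and such that the boxes of $\mu$ lying above (north-west of) $D_s$ are exactly the boxes with $R$-entry $<s$. (The part of $D_s$ between $(0,1)$ and $(m-1,m)$ runs inside $\mu$ or along its boundary.) Set $\Theta(T)=(D_1,\dots,D_k)$. *)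

(* Defs.v *)
From mathcomp Require Import all_boot.

Set Implicit Arguments.
Unset Strict Implicit.
Unset Printing Implicit Defensive.

(* Vertices are numbered from 0: v : 'I_n is the vertex labelled v.+1.        *)
(* A pair of vertices is an ordered pair (i, j) with i < j.                   *)
Notation vpair n := ('I_n * 'I_n)%type.

Definition sides (n : nat) : {set vpair n} :=
  [set e : vpair n |
    (e.2 == e.1.+1 :> nat) || ((e.1 == 0 :> nat) && (e.2 == n.-1 :> nat))].

Definition diagonals (n : nat) : {set vpair n} :=
  [set e : vpair n | e.1 < e.2] :\: sides n.

Definition cross (n : nat) (e f : vpair n) : bool :=
  [&& e.1 < f.1, f.1 < e.2 & e.2 < f.2] || [&& f.1 < e.1, e.1 < f.2 & f.2 < e.2].

Definition mutually_crossing (n : nat) (S : {set vpair n}) : bool :=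
  [forall e in S, forall f in S, (e != f) ==> cross e f].

Definition crossing_free (n k : nat) (T : {set vpair n}) : bool :=
  [forall S : {set vpair n},
    (S \subset T) && (#|S| == k.+1) ==> ~~ mutually_crossing S].

Definition ktriangulations (n k : nat) : {set {set vpair n}} :=
  [set T | maxset (fun T' : {set vpair n} =>
                     (T' \subset diagonals n) && crossing_free k T') T].

(* Boxes are pairs (row, column), both starting at 1.  stair N lists the      *)
(* boxes (r, c) with r + c <= N, i.e. those of the partition (N-1, ..., 1),   *)
(* rows from top to bottom and each row from right to left.                   *)
Definition stair (N : nat) : seq (nat * nat) :=
  [seq (r, c) | r <- iota 1 N.-1, c <- rev (iota 1 (N - r))].

(* Labels i = e.1.+1 and j = e.2.+1 give the box (n + 1 - j, i).              *)
Definition box_of (n : nat) (e : vpair n) : nat * nat := (n - e.2, e.1.+1).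

Definition filling (n : nat) (T : {set vpair n}) : seq (nat * nat) :=
  [seq box_of e | e in sides n :|: T].

Definition biword_of (n : nat) (F : seq (nat * nat)) : seq (nat * nat) :=
  [seq (b.1, (b.1 + b.2).-1) | b <- stair n & b \notin F].

(* A tableau is the sequence of its columns, each read from top to bottom.    *)
Definition tableau := seq (seq nat).

Definition entry (Q : tableau) (b : nat * nat) : nat :=
  nth 0 (nth [::] Q b.2.-1) b.1.-1.

Definition smallest_larger (x : nat) (C : seq nat) : nat :=
  head 0 (sort leq [seq z <- C | x < z]).

(* Returns the new tableau and the index (from 0) of the column at whose      *)
(* bottom the new box was created.                                            *)
Fixpoint insert (x : nat) (P : tableau) : tableau * nat :=
  match P with
  | [::] => ([:: [:: x]], 0)
  | C :: P1 =>
    if has (fun z => x < z) C then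
      let y := smallest_larger x C in
      if (y == x.+1) && (x \in C) then
        let: (P2, j) := insert x.+1 P1 in (C :: P2, j.+1)
      else
        let: (P2, j) := insert y P1 in (set_nth 0 C (index y C) x :: P2, j.+1)
    else (rcons C x :: P1, 0)
  end.

(* Both tableaux always have the same column lengths, so adding a at the      *)
(* bottom of column j of Q records it at the position of the new box of P.    *)
Definition record (a j : nat) (Q : tableau) : tableau :=
  set_nth [::] Q j (rcons (nth [::] Q j) a).

Definition EG_step (PQ : tableau * tableau) (ab : nat * nat) : tableau * tableau :=
  let: (P, j) := insert ab.2 PQ.1 in (P, record ab.1 j PQ.2).

Definition EG (w : seq (nat * nat)) : tableau * tableau :=
  foldl EG_step ([::], [::]) w.

Definition recording (n : nat) (T : {set vpair n}) : tableau :=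
  (EG (biword_of n (filling T))).2.

(* The j-th column of (m-1, ..., 2, 1) has m - j boxes.                       *)
Definition has_stair_shape (m : nat) (Q : tableau) : Prop :=
  map size Q = [seq m - j | j <- iota 1 m.-1].

Definition flagged_tableau (k m : nat) (Q : tableau) : Prop :=
  [/\ forall i j, (i, j) \in stair m -> 0 < entry Q (i, j) <= i + k,
      forall i j, (i, j) \in stair m -> (i, j.+1) \in stair m ->
        entry Q (i, j) <= entry Q (i, j.+1)
    & forall i j, (i, j) \in stair m -> (i.+1, j) \in stair m ->
        entry Q (i, j) < entry Q (i.+1, j)].

(* In a flagged tableau i <= Q(i,j), so the truncated subtraction is exact.   *)
Definition rpp_of (Q : tableau) (b : nat * nat) : nat := entry Q b - b.1.

Definition reverse_plane_partition (k m : nat) (R : nat * nat -> nat) : Prop :=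
  [/\ forall i j, (i, j) \in stair m -> R (i, j) <= k,
      forall i j, (i, j) \in stair m -> (i, j.+1) \in stair m ->
        R (i, j) <= R (i, j.+1)
    & forall i j, (i, j) \in stair m -> (i.+1, j) \in stair m ->
        R (i, j) <= R (i.+1, j)].

(* A lattice path is its sequence of steps: true is north, false is east.     *)
Notation lpath l := ((2 * l).-tuple bool).

Definition xpos (D : seq bool) (p : nat) : nat := count negb (take p D).
Definition ypos (D : seq bool) (p : nat) : nat := count id (take p D).

Definition dyck (l : nat) (D : lpath l) : bool :=
  (count id D == l) && [forall p : 'I_(2 * l).+1, xpos D p <= ypos D p].

(* After p steps both paths are on the antidiagonal x + y = p.                *)
Definition weakly_above (l : nat) (D D' : lpath l) : bool :=
  [forall p : 'I_(2 * l).+1, ypos D' p <= ypos D p].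

Definition fans (k l : nat) : {set k.-tuple (lpath l)} :=
  [set D : k.-tuple (lpath l) |
    [forall s, dyck (tnth D s)] &&
    [forall s : 'I_k, forall t : 'I_k,
       (s <= t) ==> weakly_above (tnth D s) (tnth D t)]].

(* Box (i, j) is the unit square with lower left corner (j - 1, m - i).       *)
(* It lies above D when the east step of D from x = j - 1 to x = j is at      *)
(* height at most m - i.                                                      *)
Definition box_above (m : nat) (D : lpath m) (b : nat * nat) : bool :=
  [exists p : 'I_(2 * m),
    [&& ~~ tnth D p, xpos D p == b.2.-1 & ypos D p <= m - b.1]].

Definition step_is_side (m : nat) (D : lpath m) (p : 'I_(2 * m))
    (b : nat * nat) : bool :=
  let: (x, y) := (b.2.-1, m - b.1) in
  if tnth D p then
    ((xpos D p == x) || (xpos D p == x.+1)) && (ypos D p == y)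
  else (xpos D p == x) && ((ypos D p == y) || (ypos D p == y.+1)).

(* The next to last clause says that D runs inside mu or along its boundary   *)
(* between (0, 1) and (m - 1, m); without it D would not be determined by     *)
(* the boxes above it, as it could go below mu.                               *)
Definition boundary_path (m : nat) (R : nat * nat -> nat) (s : nat)
    (D : lpath m) : bool :=
  [&& count id D == m, head false D, ~~ last true D,
      [forall p : 'I_(2 * m),
         (0 < p < (2 * m).-1) ==> has (step_is_side D p) (stair m)]
    & all (fun b => box_above D b == (R b < s)) (stair m)].

(* The default value is never used when boundary_path has a solution.         *)
Definition path_of (m : nat) (R : nat * nat -> nat) (s : nat) : lpath m :=
  odflt [tuple false | _ < 2 * m] [pick D : lpath m | boundary_path R s D].

Definition Theta (n k : nat) (T : {set vpair n}) : k.-tuple (lpath (n - 2 * k)) :=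
  [tuple path_of (n - 2 * k) (rpp_of (recording T)) s.+1 | s < k].

(* Main.v *)
(** Let F be the filling of a set T of diagonals.  The boxes of the staircase outside F spell, in reading order, a word in the simple transpositions.  Let w be the permutation of 1, ..., n that reverses the block k + 1, ..., n - k.  By a last-passage recursion, the longest north-east chain of F in the p x (n - p) corner has as many boxes as the 0-Hecke product pi of the word has values at most n - p in its first p positions.  So F has no (k + 1)-crossing iff these ranks are at most k, i.e. iff w <= pi in Bruhat order, i.e. iff the word has a subword that is a reduced word of w; hence T is a k-triangulation iff its word is itself a reduced word of w.

    Edelman-Greene insertion is compatible with the nil-Coxeter relations, so the insertion tableau P of a reduced word of w has, in column c, entries that are increasing and lie in c + k, ..., n - k - 1; having as many boxes as w has inversions, P is the full staircase P0 with P0(i, j) = k + i + j - 1.  Thus T is determined by Q, and conversely uninserting P0 along any flagged Q yields a reduced word of w.  The flag condition on Q matches a <= b on the biword: inserting b puts into column j only values at least b + j - 1, so a + j - 1 <= P0(i, j) for a recorded at (i, j); and a box created in row i comes from some b >= k + i. *)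
From Stdlib Require Import FunctionalExtensionality.
Require Import Defs.
From mathcomp Require Import all_boot perm zify.

Set Implicit Arguments.
Unset Strict Implicit.
Unset Printing Implicit Defensive.

(** * Permutations and words *)

(** Insertion into a column may misbehave on arbitrary words: if [x] is already in the column and
    the next larger entry is not [x.+1], a second [x] is created. Reducedness of the reading word
    followed by the new letter excludes this, since the two copies of [x] would be separated only by
    letters commuting with [x]. So this hypothesis accompanies the statements about insertion, and
    it has to be handed on to the bumped letter and the remaining columns; the relations that give
    invariance also do this.

    On the polygon side, fix [q] and keep of a permutation only which positions hold a value at most
    [q]. The 0-Hecke action descends to these 0/1 sequences, and its effect at one box is the
    last-passage recursion for chains. This controls only the ranks with p + q = n, but they
    suffice: a rank is monotone in [q] and grows by at most one per position, so the bound k on that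
    antidiagonal spreads to k + max(0, p + q - n), and together with the trivial bound min(p, q)
    this is the rank function of w. *)

Definition swap (A : Type) (s : nat -> A) (b : nat) : nat -> A :=
  fun i => if i == b then s b.+1 else if i == b.+1 then s b else s i.

(* Nil-Coxeter action on the one-line notation, positions starting at 1: a letter b swaps the values at b and b + 1 if they increase; None records that the word is not reduced. *)
Definition nil_step (o : option (nat -> nat)) (b : nat) :=
  if o is Some s then if s b < s b.+1 then Some (swap s b) else None else None.

Definition nil_act (o : option (nat -> nat)) (u : seq nat) := foldl nil_step o u.

(** Every starting state is allowed, also [None] and functions that are not permutations; this makes
    the relation a two-sided congruence for concatenation. *)
Definition nil_eq (u v : seq nat) := forall o, nil_act o u = nil_act o v.

Definition reduced (u : seq nat) : bool := isSome (nil_act (Some id) u).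

Lemma nil_act_cat o u v : nil_act o (u ++ v) = nil_act (nil_act o u) v.
Proof. exact: foldl_cat. Qed.

Lemma nil_act_none u : nil_act None u = None.
Proof. by elim: u. Qed.

Lemma nil_eq_refl u : nil_eq u u. Proof. by []. Qed.

Lemma nil_eq_sym u v : nil_eq u v -> nil_eq v u.
Proof. by move=> h o; rewrite h. Qed.

Lemma nil_eq_trans v u t : nil_eq u v -> nil_eq v t -> nil_eq u t.
Proof. by move=> h1 h2 o; rewrite h1 h2. Qed.

Lemma nil_eq_cat u u' v v' : nil_eq u u' -> nil_eq v v' -> nil_eq (u ++ v) (u' ++ v').
Proof. by move=> h1 h2 o; rewrite !nil_act_cat h1 h2. Qed.

Lemma reduced_eq u v : nil_eq u v -> reduced u = reduced v.
Proof. by move=> h; rewrite /reduced h. Qed.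

Lemma reduced_prefix u v : reduced (u ++ v) -> reduced u.
Proof.
rewrite /reduced nil_act_cat; case: (nil_act _ u) => //=.
by rewrite nil_act_none.
Qed.

Lemma swapE (A : Type) (s : nat -> A) b i : i != b -> i != b.+1 -> swap s b i = s i.
Proof. by rewrite /swap => /negbTE-> /negbTE->. Qed.

Lemma swapl (A : Type) (s : nat -> A) b : swap s b b = s b.+1.
Proof. by rewrite /swap eqxx. Qed.

Lemma swapr (A : Type) (s : nat -> A) b : swap s b b.+1 = s b.
Proof. by rewrite /swap eqxx; case: eqP => //; lia. Qed.

Lemma swap_comm (A : Type) (s : nat -> A) a b :
  a.+1 < b -> swap (swap s a) b = swap (swap s b) a.
Proof.
move=> hab; apply: functional_extensionality => i.
have [->|n1] := eqVneq i a; first by rewrite !(swapl, swapr, swapE) //; lia.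
have [->|n2] := eqVneq i a.+1; first by rewrite !(swapl, swapr, swapE) //; lia.
have [->|n3] := eqVneq i b; first by rewrite !(swapl, swapr, swapE) //; lia.
have [->|n4] := eqVneq i b.+1; first by rewrite !(swapl, swapr, swapE) //; lia.
by rewrite !swapE.
Qed.

Lemma swapK (A : Type) (s : nat -> A) b : swap (swap s b) b = s.
Proof.
apply: functional_extensionality => i; rewrite {1}/swap swapl swapr /swap.
by do !case: eqP => ? //; subst.
Qed.

Lemma nil_comm a b : a.+1 < b -> nil_eq [:: a; b] [:: b; a].
Proof.
move=> hab [s|//]; rewrite /nil_act /=.
have e1 : swap s a b = s b by apply: swapE; lia.
have e2 : swap s a b.+1 = s b.+1 by apply: swapE; lia.
have e3 : swap s b a = s a by apply: swapE; lia.
have e4 : swap s b a.+1 = s a.+1 by apply: swapE; lia.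
case ha: (s a < s a.+1); case hb: (s b < s b.+1) => /=;
  rewrite ?e1 ?e2 ?e3 ?e4 ?ha ?hb //.
by rewrite swap_comm.
Qed.

Lemma nil_sq b o : nil_act o [:: b; b] = None.
Proof.
case: o => //= s; rewrite /nil_act /=; case: ltnP => //= h.
by rewrite swapl swapr ltnNge (ltnW h).
Qed.

(** Either word succeeds exactly when the values at [b], [b.+1], [b.+2] increase, and then reverses
    these three values. *)
Lemma nil_braid b : nil_eq [:: b; b.+1; b] [:: b.+1; b; b.+1].
Proof.
move=> [s|//]; rewrite /nil_act /=.
have e1 t : swap t b b = t b.+1 :> nat by rewrite swapl.
have e2 t : swap t b b.+1 = t b :> nat by rewrite swapr.
have e3 t : swap t b b.+2 = t b.+2 :> nat by rewrite swapE //; lia.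
have f1 t : swap t b.+1 b = t b :> nat by rewrite swapE //; lia.
have f2 t : swap t b.+1 b.+1 = t b.+2 :> nat by rewrite swapl.
have f3 t : swap t b.+1 b.+2 = t b.+1 :> nat by rewrite swapr.
do ![case: ltnP => /=; rewrite ?(e1, e2, e3, f1, f2, f3) => ?]; try lia; try done.
congr Some; apply: functional_extensionality => i.
have [->|n1] := eqVneq i b; first by rewrite !(swapl, swapr, swapE) //; lia.
have [->|n2] := eqVneq i b.+1; first by rewrite !(swapl, swapr, swapE) //; lia.
have [->|n3] := eqVneq i b.+2; first by rewrite !(swapl, swapr, swapE) //; lia.
by rewrite !swapE //; lia.
Qed.

Definition far (x z : nat) : bool := (z.+1 < x) || (x.+1 < z).

Lemma nil_far x u : all (far x) u -> nil_eq (x :: u) (rcons u x).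
Proof.
elim: u => [//|z u IH] /= /andP[hz hu].
apply: (@nil_eq_trans ([:: z] ++ (x :: u))).
  apply: (@nil_eq_cat [:: x; z] [:: z; x] u u) => //.
  by case/orP: hz => h; [apply: nil_eq_sym|]; apply: nil_comm.
by apply: (@nil_eq_cat [:: z] [:: z]) => //; apply: IH.
Qed.

(** The first [x] commutes up to the second and meets it. In this form reducedness is used to
    exclude cases of insertion. *)
Lemma nil_farsq x u o : all (far x) u -> nil_act o (x :: rcons u x) = None.
Proof.
move=> h; rewrite -cats1 -cat_cons nil_act_cat (nil_far h) -nil_act_cat.
by rewrite -cats1 -catA nil_act_cat nil_sq.
Qed.

(* The 0-Hecke action: letters at descents act trivially, so [dem id u] is the Demazure product. *)
Definition dem_step (s : nat -> nat) (b : nat) := if s b < s b.+1 then swap s b else s.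
Definition dem := foldl dem_step.

(** * Rank functions and Bruhat order *)

Definition rk (s : nat -> nat) (p q : nat) : nat := \sum_(1 <= i < p.+1) (s i <= q).

Lemma rk0 s q : rk s 0 q = 0.
Proof. by rewrite /rk big_geq. Qed.

Lemma rkS s p q : rk s p.+1 q = rk s p q + (s p.+1 <= q).
Proof. by rewrite /rk big_nat_recr. Qed.

Lemma nil_dem s u t : nil_act (Some s) u = Some t -> dem s u = t.
Proof.
elim: u s => [|b u IH] s /=; first by case.
rewrite /dem_step; case: ifP => _; first exact: IH.
by rewrite -/(nil_act _ _) nil_act_none.
Qed.

Lemma rk_swap s b p q : p != b.+1 -> rk (swap s b.+1) p q = rk s p q.
Proof.
elim: p {-2}p (leqnn p) => [|N IH] [|p] hp hb; rewrite ?rk0 //.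
have [e|ne] := eqVneq p b.+1.
  subst p; rewrite !rkS swapr swapl.
  by rewrite (IH b) //; [lia..].
rewrite !rkS (IH p) //.
by rewrite swapE //; lia.
Qed.

Lemma rk_dem s b p q : rk (dem_step s b.+1) p q <= rk s p q.
Proof.
rewrite /dem_step; case: ltnP => // h.
have [->|ne] := eqVneq p b.+1; last by rewrite rk_swap.
by rewrite !rkS swapl rk_swap //; lia.
Qed.

Lemma rk_id p q : rk id p q = minn p q.
Proof. by elim: p => [|p IH]; rewrite ?rk0 ?rkS ?IH; lia. Qed.

Lemma rk_dem_word s u p q : 0 \notin u -> rk (dem s u) p q <= rk s p q.
Proof.
elim: u s => [//|[//|b] u IH] s; rewrite inE negb_or /= => hu.
exact: leq_trans (IH _ hu) (rk_dem _ _ _ _).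
Qed.

(** The rank criterion for Bruhat order: going up lowers ranks, so for permutations this says that
    [s] lies below [t]. *)
Definition rk_ge (s t : nat -> nat) := forall p q, rk t p q <= rk s p q.

(** One half of the lifting property. Only the ranks with [p = b.+1] differ between [t] and its
    image, and they are controlled from [p = b] and [p = b.+2]: if [s b.+2 <= q], the rank of [t]
    grows by at most one after position [b]; otherwise the ranks of [s] at [b] and [b.+2] agree. *)
Lemma rk_ge_swap s t b : rk_ge s (dem_step t b.+1) -> s b.+2 < s b.+1 ->
  rk_ge (swap s b.+1) t.
Proof.
move=> h hs p q; have [->|ne] := eqVneq p b.+1; last first.
  rewrite rk_swap //; apply: leq_trans (h p q); rewrite /dem_step.
  by case: ifP => // _; rewrite rk_swap.
have -> : rk (swap s b.+1) b.+1 q = rk s b q + (s b.+2 <= q).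
  by rewrite rkS swapl rk_swap //; lia.
have := h b q; have := h b.+2 q.
rewrite /dem_step; case: ifP => _; rewrite ?rk_swap; try lia.
  by rewrite !rkS; lia.
by rewrite !rkS; lia.
Qed.

Lemma rk_ge_skip s t b : rk_ge s (dem_step t b.+1) -> s b.+1 < s b.+2 -> rk_ge s t.
Proof.
move=> h hs p q; have [->|ne] := eqVneq p b.+1; last first.
  apply: leq_trans (h p q); rewrite /dem_step.
  by case: ifP => // _; rewrite rk_swap.
have := h b q; have := h b.+2 q.
rewrite /dem_step; case: ifP => _; rewrite ?rk_swap; try lia.
  by rewrite !rkS; lia.
by rewrite !rkS; lia.
Qed.

Lemma rk_ge_id s : injective s -> s 0 = 0 -> rk_ge s id -> s = id.
Proof.
move=> inj s0 h; apply: functional_extensionality => i.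
have le p q : rk s p q <= p by elim: p => [|p IH]; rewrite ?rk0 ?rkS; lia.
have sle j : s j <= j.
  case: j => [|j]; first by rewrite s0.
  have := h j.+1 j.+1; rewrite rk_id minnn rkS.
  by have := le j j.+1; case: (s j.+1 <= j.+1) => //; lia.
elim/ltn_ind: i => i IH.
have := sle i; rewrite leq_eqVlt => /orP[/eqP //|hlt].
by have := inj _ _ (IH _ hlt); lia.
Qed.

(* The lifting property: scanning the word from the right, a letter is kept exactly when it is a descent of the permutation still to be reached. *)
Lemma dem_subword s u : injective s -> s 0 = 0 -> 0 \notin u -> rk_ge s (dem id u) ->
  exists2 m, size m = size u & nil_act (Some id) (mask m u) = Some s.
Proof.
elim/last_ind: u s => [|u b IH] s inj s0 hu h.
  by exists [::] => //=; rewrite (rk_ge_id inj s0 h).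
move: hu; rewrite mem_rcons inE negb_or => /andP[b0 hu].
case: b b0 h => [//|b] _; rewrite /dem foldl_rcons => h.
have [hs|hs|/inj] := ltngtP (s b.+1) (s b.+2); last by lia.
- have [m sm hm] := IH s inj s0 hu (rk_ge_skip h hs).
  exists (rcons m false); rewrite ?size_rcons ?sm //.
  by rewrite mask_rcons // cats0.
- have inj' : injective (swap s b.+1).
    by move=> i j; rewrite /swap; do !case: eqP => ?; move=> /inj; lia.
  have s0' : swap s b.+1 0 = 0 by rewrite swapE.
  have [m sm hm] := IH _ inj' s0' hu (rk_ge_swap h hs).
  exists (rcons m true); rewrite ?size_rcons ?sm //.
  by rewrite mask_rcons //= nil_act_cat hm /= /nil_act /= swapl swapr hs swapK.
Qed.

(** * Inversions and the block reversal *)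

Definition inv (N : nat) (s : nat -> nat) : nat :=
  \sum_(x : 'I_N * 'I_N) ((x.1 < x.2) && (s x.2 < s x.1)).

Lemma inv_swap N s b : b.+1 < N -> s b < s b.+1 -> inv N (swap s b) = (inv N s).+1.
Proof.
move=> hb hs; pose o0 := Ordinal (ltnW hb); pose o1 := Ordinal hb.
pose f := tperm o0 o1.
pose g (x : 'I_N * 'I_N) := (f x.1, f x.2).
have gK : involutive g by case=> i j; rewrite /g /= !tpermK.
have fE i : swap s b (f i) = s i.
  rewrite /f; case: tpermP => [->|->|h0 h1] /=; rewrite ?swapl ?swapr //.
  rewrite swapE //; apply/eqP => e; [apply: h0|apply: h1]; exact: val_inj.
have mono i j : (i != o1) || (j != o0) -> (i != o0) || (j != o1) ->
    (f i < f j) = (i < j).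
  rewrite /f; case: tpermP => [->|->|/eqP i0 /eqP i1]; case: tpermP => [->|->|/eqP j0 /eqP j1] /=;
    rewrite ?eqxx ?ltnn //= => _ _.
  - by move: j0 j1; rewrite -!val_eqE /=; lia.
  - by move: j0 j1; rewrite -!val_eqE /=; lia.
  - by move: i0 i1; rewrite -!val_eqE /=; lia.
  - by move: i0 i1; rewrite -!val_eqE /=; lia.
(* Reindexing pairs of positions by the transposition makes the two sums agree except at [(o1, o0)],
   which contributes the new inversion; at [(o0, o1)] both terms vanish because [s b < s b.+1]. *)
rewrite /inv (reindex_inj (inv_inj gK)) /=.
rewrite (bigD1 (o1, o0)) //= [in RHS](bigD1 (o1, o0)) //=.
rewrite !fE /f tpermL tpermR /= hs ltnS leqnn /= ltnNge leqnSn /= add0n add1n.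
congr _.+1; apply: eq_bigr => -[i j]; rewrite xpair_eqE negb_and /= => hij.
rewrite !fE.
have [/andP[/eqP-> /eqP->]|hij'] := boolP ((i == o0) && (j == o1)).
  by rewrite /f tpermL tpermR /= [s b.+1 < s b]ltnNge (ltnW hs) !andbF.
by rewrite mono // -negb_and.
Qed.

Lemma inv_nil_act N s t u : nil_act (Some s) u = Some t ->
  all (fun b => b.+1 < N) u -> inv N t = inv N s + size u.
Proof.
elim: u s => [|b u IH] s /=; first by case=> ->; rewrite addn0.
case: ltnP => h; last by rewrite -/(nil_act _ _) nil_act_none.
by move=> hu /andP[hb hN]; rewrite (IH _ hu hN) inv_swap // addnS.
Qed.

Definition wrev (n k : nat) (i : nat) : nat := if k < i <= n - k then n.+1 - i else i.

Lemma wrev_inj n k : 2 * k < n -> injective (wrev n k).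
Proof. by move=> h i j; rewrite /wrev; do 2!case: ifP; lia. Qed.

Lemma wrev0 n k : wrev n k 0 = 0. Proof. by []. Qed.

Lemma rk_wrev n k p q : 2 * k < n ->
  rk (wrev n k) p q = minn (minn p q) (k + (p + q - n)).
Proof.
move=> h; elim: p => [|p IH]; first by rewrite rk0; lia.
by rewrite rkS IH /wrev; case: ifP; lia.
Qed.

Lemma nil_act_fix0 s t u : nil_act (Some s) u = Some t -> s 0 <= t 0 /\ (0 \in u -> s 0 < t 0).
Proof.
elim: u s => [|b u IH] s /=; first by case=> ->.
case: ltnP => h; last by rewrite -/(nil_act _ _) nil_act_none.
move=> /IH []; rewrite inE; case: b h => [|b] h; rewrite /swap /=; first by lia.
by move=> h1 h2; split.
Qed.

(** Just after a letter [b] has acted at an ascent, fewer than [b] of the first [b] positions hold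
    values at most [b], and later letters only lower ranks. So [wrev n k] has rank below [b] at
    [(b, b)], which by the rank formula happens only inside the reversed block. *)
Lemma wrev_letters n k u : 2 * k < n -> nil_act (Some id) u = Some (wrev n k) ->
  forall b, b \in u -> k < b < n - k.
Proof.
move=> kn hu; have u0 : 0 \notin u.
  by apply/negP => /(proj2 (nil_act_fix0 hu)); rewrite wrev0.
move=> b; case: b => [|b]; first by rewrite (negbTE u0).
move=> hb; suff : rk (wrev n k) b.+1 b.+1 < b.+1 by rewrite rk_wrev //; lia.
move: hu u0; case/splitPr: hb => u1 u2; rewrite nil_act_cat.
case e1: (nil_act (Some id) u1) => [s|] /=; last first.
  by rewrite -/(nil_act _ _) nil_act_none.
case: ltnP => h; last by rewrite -/(nil_act _ _) nil_act_none.
rewrite mem_cat inE !negb_or /= => /nil_dem <- /andP[u10 u20].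
apply: leq_ltn_trans (rk_dem_word _ _ _ u20) _.
rewrite rkS swapl rk_swap; last by lia.
have := rk_dem_word id b.+2 b.+1 u10; rewrite (nil_dem e1) rk_id !rkS.
have le p q : rk s p q <= p by elim: p => [|p IH]; rewrite ?rk0 ?rkS; lia.
by have := le b b.+1; lia.
Qed.

(** Columns are read from right to left, so a letter appended to the word stands next to the first
    column, where its insertion starts. *)
Fixpoint rd (P : tableau) : seq nat := if P is C :: P1 then rd P1 ++ C else [::].

(* The insertion tableau of every reduced word of the permutation reversing lo, ..., lo + d. *)
Fixpoint rev_tab (lo d : nat) : tableau :=
  if d is d'.+1 then iota lo d :: rev_tab lo.+1 d' else [::].

Lemma nil_act_run s lo d : (forall i, lo < i <= lo + d -> s lo < s i) ->
  nil_act (Some s) (iota lo d) =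
  Some (fun i => if lo <= i < lo + d then s i.+1 else if i == lo + d then s lo else s i).
Proof.
elim: d => [|d IH] hs.
  congr Some; apply: functional_extensionality => i.
  by rewrite addn0 ltnNge andbN; case: eqP => [->|].
rewrite -addn1 iotaD nil_act_cat IH; last by move=> i hi; apply: hs; lia.
set f := fun i => _.
have f0 : f (lo + d) = s lo by rewrite /f ltnn andbF eqxx.
have f1 : f (lo + d).+1 = s (lo + d).+1 by rewrite /f !ifF //; lia.
rewrite /nil_act /= f0 f1 hs; last by lia.
congr Some; apply: functional_extensionality => i; rewrite /swap f0 f1 addn1.
have [->|n1] := eqVneq i (lo + d); first by rewrite leq_addr addnS leqnn.
have [->|n2] := eqVneq i (lo + d).+1; first by rewrite addnS ltnn andbF eqxx.
have -> : (lo <= i < lo + d.+1) = (lo <= i < lo + d) by lia.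
by rewrite /f addnS (negbTE n1) (negbTE n2).
Qed.

Lemma nil_act_rev_tab lo d : nil_act (Some id) (rd (rev_tab lo d)) =
  Some (fun i => if lo <= i <= lo + d then lo + d + lo - i else i).
Proof.
elim: d lo => [|d IH] lo.
  by congr Some; apply: functional_extensionality => i; case: ifP; lia.
have -> : rd (rev_tab lo d.+1) = rd (rev_tab lo.+1 d) ++ iota lo d.+1 by [].
rewrite nil_act_cat IH nil_act_run; last first.
  by move=> i hi; do 2!case: ifP; lia.
congr Some; apply: functional_extensionality => i.
by do !case: ifP => ?; lia.
Qed.

Lemma nil_act_wrev n k : 2 * k < n ->
  nil_act (Some id) (rd (rev_tab k.+1 (n - 2 * k).-1)) = Some (wrev n k).
Proof.
move=> h; rewrite nil_act_rev_tab; congr Some; apply: functional_extensionality => i.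
by rewrite /wrev; do 2!case: ifP; lia.
Qed.

Lemma size_wrev_word n k u v : 2 * k < n ->
  nil_act (Some id) u = Some (wrev n k) -> nil_act (Some id) v = Some (wrev n k) ->
  size u = size v.
Proof.
move=> h hu hv.
have small t : nil_act (Some id) t = Some (wrev n k) -> all (fun b => b.+1 < n.+1) t.
  by move=> ht; apply/allP => b /(wrev_letters h ht); lia.
have := inv_nil_act hu (small _ hu); rewrite (inv_nil_act hv (small _ hv)).
by move=> /addnI.
Qed.

(** * Column insertion *)

Lemma reduced_farsq u x t : all (far x) t -> reduced (u ++ x :: rcons t x) = false.
Proof. by move=> h; rewrite /reduced nil_act_cat nil_farsq. Qed.

Lemma sorted_ltn_cat A y B : sorted ltn (A ++ y :: B) =
  [&& sorted ltn A, all (fun z => z < y) A, all (fun z => y < z) B & sorted ltn B].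
Proof.
rewrite !(sorted_pairwise ltn_trans) pairwise_cat /= allrel_consr.
apply/idP/idP.
  by move=> /and3P[/andP[-> h] -> /andP[-> ->]].
move=> /and4P[-> hA hB ->]; rewrite hA hB /= !andbT.
apply/allrelP => a b /(allP hA) /= h1 /(allP hB) /=; exact: ltn_trans.
Qed.

Lemma smallest_largerE x A y B : sorted ltn (A ++ y :: B) ->
  all (fun z => z <= x) A -> x < y -> smallest_larger x (A ++ y :: B) = y.
Proof.
rewrite sorted_ltn_cat => /and4P[_ _ hB sB] hA xy; rewrite /smallest_larger filter_cat.
have -> : [seq z <- A | x < z] = [::].
  by apply/eqP; rewrite -[_ == _]negbK -has_filter -all_predC; apply: sub_all hA => z /=; lia.
rewrite /= xy (all_filterP _); last by apply: sub_all hB => z; exact: ltn_trans.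
rewrite (sorted_sort leq_trans) //; apply: (@sub_sorted _ ltn) => [a b|].
  exact: ltnW.
by rewrite /= (path_sortedE ltn_trans) hB.
Qed.

Lemma bump_set A y B x : all (fun z => z < y) A ->
  set_nth 0 (A ++ y :: B) (index y (A ++ y :: B)) x = A ++ x :: B.
Proof.
move=> hA; have -> : index y (A ++ y :: B) = size A.
  rewrite index_cat ifF /= ?eqxx ?addn0 //.
  by apply/negP => /(allP hA); rewrite /= ltnn.
by elim: A {hA} => //= a A ->.
Qed.

Lemma sorted_split y C : sorted ltn C ->
  C = [seq z <- C | z < y] ++ [seq z <- C | y <= z].
Proof.
elim: C => //= c C IH hC; have sC := path_sorted hC.
case: ltnP => h /=; first by rewrite -IH.
have hall : all (fun z => y <= z) C.
  apply: sub_all (order_path_min ltn_trans hC) => z /=; lia.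
rewrite (all_filterP hall).
suff -> : [seq z <- C | z < y] = [::] by [].
by apply/eqP; rewrite -[_ == _]negbK -has_filter -all_predC; apply: sub_all hall => z /=; lia.
Qed.

Lemma last_below C y : sorted ltn C -> y \notin C -> has (fun z => z < y) C ->
  exists A x B, [/\ C = A ++ x :: B, x < y & all (fun z => y < z) B].
Proof.
move=> sC yC; rewrite has_filter.
move: (sorted_split y sC) (filter_all (fun z => z < y) C).
case/lastP: [seq z <- C | z < y] => // A x eC hA _.
exists A, x, [seq z <- C | y <= z]; split; first by rewrite {1}eC cat_rcons.
  by move: hA; rewrite all_rcons => /andP[].
apply/allP => z; rewrite mem_filter => /andP[h zC].
by rewrite ltn_neqAle h andbT; apply: contraNneq yC => ->.
Qed.

Inductive insert_spec x C P1 : tableau * nat -> Prop :=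
| InsertAppend of all (fun z => z < x) C : insert_spec x C P1 (rcons C x :: P1, 0)
| InsertSkip A B P2 j of C = A ++ [:: x, x.+1 & B] & all (fun z => z < x) A
    & all (fun z => x.+1 < z) B & insert x.+1 P1 = (P2, j) :
    insert_spec x C P1 (C :: P2, j.+1)
| InsertBump A y B P2 j of C = A ++ y :: B & all (fun z => z < x) A & x < y
    & all (fun z => y < z) B & insert y P1 = (P2, j) :
    insert_spec x C P1 ((A ++ x :: B) :: P2, j.+1).

Lemma insert_appendE x C P1 : all (fun z => z < x) C -> insert x (C :: P1) = (rcons C x :: P1, 0).
Proof.
move=> h /=; rewrite ifN //; rewrite -all_predC; apply: sub_all h => z /=; lia.
Qed.

Lemma insert_skipE x A B P1 : sorted ltn (A ++ [:: x, x.+1 & B]) ->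
  insert x ((A ++ [:: x, x.+1 & B]) :: P1) =
  ((A ++ [:: x, x.+1 & B]) :: (insert x.+1 P1).1, (insert x.+1 P1).2.+1).
Proof.
move=> s; have := s; rewrite sorted_ltn_cat => /and4P[_ hA _ _].
have hh : has (fun z => x < z) (A ++ [:: x, x.+1 & B]).
  by apply/hasP; exists x.+1; rewrite ?mem_cat ?inE ?eqxx ?orbT /=.
rewrite [insert _ _]/= hh.
rewrite -cat_rcons smallest_largerE ?cat_rcons //; last first.
  by rewrite all_rcons leqnn; apply: sub_all hA => z; exact: ltnW.
by rewrite eqxx mem_cat inE eqxx orbT /=; case: insert.
Qed.

Lemma insert_bumpE x A y B P1 : sorted ltn (A ++ y :: B) -> all (fun z => z < x) A -> x < y ->
  insert x ((A ++ y :: B) :: P1) = ((A ++ x :: B) :: (insert y P1).1, (insert y P1).2.+1).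
Proof.
move=> s hA xy; have := s; rewrite sorted_ltn_cat => /and4P[_ hAy hB _].
rewrite [insert _ _]/= has_cat /= xy orbT smallest_largerE //; last first.
  by apply: sub_all hA => z; exact: ltnW.
rewrite (bump_set _ _ hAy) ifN; first by case: insert.
rewrite negb_and; apply/orP; right; rewrite mem_cat inE !negb_or.
rewrite (ltn_eqF xy) /=; apply/andP; split.
  by apply/negP => /(allP hA) /=; rewrite ltnn.
by apply/negP => /(allP hB) /=; rewrite ltnNge (ltnW xy).
Qed.

(** What remains to be excluded is [x] in the column without [x.+1]: then every entry after [x] is
    at least [x + 2], and the appended [x] would commute back to the first copy, against
    reducedness. The word [u] stands for whatever precedes the first column. *)
Lemma insertP x P u : sorted ltn (head [::] P) -> reduced (u ++ rcons (head [::] P) x) ->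
  insert_spec x (head [::] P) (behead P) (insert x P).
Proof.
case: P => [|C P1] /=; first by move=> _ _; exact: (@InsertAppend x [::] [::]).
move=> sC red; rewrite -[if _ then _ else _]/(insert x (C :: P1)).
have [xC|xC] := boolP (x \in C); last first.
  have eC := sorted_split x sC; set A := filter _ _ in eC; set D := filter _ _ in eC.
  have hA : all (fun z => z < x) A by exact: filter_all.
  have hD : all (fun z => x < z) D.
    apply/allP => z; rewrite mem_filter => /andP[h zC].
    by rewrite ltn_neqAle h andbT; apply: contraNneq xC => ->.
  case: D hD eC => [|y B].
    by rewrite cats0 => _ eC; rewrite insert_appendE ?eC //; exact: InsertAppend.
  move=> /andP[xy _] eC; have := sC; rewrite eC => s; rewrite insert_bumpE //.
  case e : (insert y P1) => [P2 j]; apply: InsertBump e => //.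
  by move: s; rewrite sorted_ltn_cat => /and4P[].
case/splitPr: xC sC red => A D sC red.
have := sC; rewrite sorted_ltn_cat => /and4P[sA hA hD sD].
case: D sC red hD sD => [|y B] sC red hD sD.
  by move: red; rewrite cats1 -cats1 cat_rcons catA (@reduced_farsq (u ++ A) x [::]).
case/andP: hD => xy hB; rewrite /= in xy sD.
have hyB := order_path_min ltn_trans sD.
have [ey|ne] := eqVneq y x.+1.
  subst y; rewrite insert_skipE //.
  by case e : (insert x.+1 P1) => [P2 j]; apply: InsertSkip e.
move: red; rewrite -cats1 -catA /= !cats1 catA -rcons_cons (reduced_farsq (u ++ A)) //=.
rewrite /far; apply/andP; split; first by lia.
by apply: sub_all hyB => z /=; lia.
Qed.

(** Commutations alone: [x] moves left past [B], whose entries exceed [y], and [y] moves left past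
    [A], whose entries are below [x]. *)
Lemma nil_eq_bump A x y B : all (fun z => z < x) A -> x < y -> all (fun z => y < z) B ->
  nil_eq (rcons (A ++ y :: B) x) (y :: A ++ x :: B).
Proof.
move=> hA xy hB; rewrite rcons_cat rcons_cons.
apply: (@nil_eq_trans (A ++ y :: x :: B)).
  apply: nil_eq_cat => //; apply: (@nil_eq_cat [:: y] [:: y]) => //.
  by apply: nil_eq_sym; apply: nil_far; apply: sub_all hB => z; rewrite /far; lia.
rewrite -cat_rcons -cat_cons; apply: nil_eq_cat => //; apply: nil_eq_sym; apply: nil_far.
by apply: sub_all hA => z; rewrite /far; lia.
Qed.

(** After [x] has passed [B], the braid relation replaces [x, x.+1, x] by [x.+1, x, x.+1], and the
    leading [x.+1] passes [A]. The insertion clause that leaves the column unchanged is made for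
    this relation. *)
Lemma nil_eq_skip A x B : all (fun z => z < x) A -> all (fun z => x.+1 < z) B ->
  nil_eq (rcons (A ++ [:: x, x.+1 & B]) x) (x.+1 :: A ++ [:: x, x.+1 & B]).
Proof.
move=> hA hB; rewrite rcons_cat !rcons_cons.
apply: (@nil_eq_trans (A ++ [:: x, x.+1, x & B])).
  apply: nil_eq_cat => //; apply: (@nil_eq_cat [:: x; x.+1] [:: x; x.+1]) => //.
  by apply: nil_eq_sym; apply: nil_far; apply: sub_all hB => z; rewrite /far; lia.
apply: (@nil_eq_trans (A ++ [:: x.+1, x, x.+1 & B])).
  apply: nil_eq_cat => //; apply: (@nil_eq_cat [:: x; x.+1; x] [:: x.+1; x; x.+1] B B) => //.
  exact: nil_braid.
rewrite -cat_rcons -cat_cons; apply: nil_eq_cat => //; apply: nil_eq_sym; apply: nil_far.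
by apply: sub_all hA => z; rewrite /far; lia.
Qed.

(* A counting form of: E is not longer than C and [nth 0 C i < nth 0 E i] for all [i < size E]. *)
Definition dom (C E : seq nat) : Prop :=
  forall v, count (fun z => z <= v) E <= count (fun z => z < v) C.

Fixpoint tab (P : tableau) : Prop :=
  if P is C :: P1 then [/\ C != [::], sorted ltn C, dom C (head [::] P1) & tab P1] else True.

Lemma tab_head P : tab P -> sorted ltn (head [::] P).
Proof. by case: P => [|C P1] //= []. Qed.

Lemma tab_behead P : tab P -> tab (behead P).
Proof. by case: P => [|C P1] //= []. Qed.

Lemma rd_head P : rd P = rd (behead P) ++ head [::] P.
Proof. by case: P. Qed.

(** Each case is bundled with what an induction on columns needs: the bumped letter is again reduced
    after the remaining columns, and the passage through the first column respects the relations. *)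
Inductive tab_insert_spec x P : tableau * nat -> Prop :=
| TabAppend of all (fun z => z < x) (head [::] P) :
    tab_insert_spec x P (rcons (head [::] P) x :: behead P, 0)
| TabSkip A B P2 j of head [::] P = A ++ [:: x, x.+1 & B] & all (fun z => z < x) A
    & all (fun z => x.+1 < z) B & insert x.+1 (behead P) = (P2, j)
    & reduced (rd (behead P) ++ [:: x.+1])
    & nil_eq (rd P ++ [:: x]) ((rd (behead P) ++ [:: x.+1]) ++ head [::] P) :
    tab_insert_spec x P (head [::] P :: P2, j.+1)
| TabBump A y B P2 j of head [::] P = A ++ y :: B & all (fun z => z < x) A & x < y
    & all (fun z => y < z) B & insert y (behead P) = (P2, j)
    & reduced (rd (behead P) ++ [:: y])
    & nil_eq (rd P ++ [:: x]) ((rd (behead P) ++ [:: y]) ++ A ++ x :: B) :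
    tab_insert_spec x P ((A ++ x :: B) :: P2, j.+1).

Lemma tab_insertP x P : tab P -> reduced (rd P ++ [:: x]) ->
  tab_insert_spec x P (insert x P).
Proof.
move=> tP red.
have eP : rd P ++ [:: x] = rd (behead P) ++ rcons (head [::] P) x.
  by rewrite rd_head -catA cats1.
have := red; rewrite eP => /(insertP (tab_head tP)).
case=> [hC|A B P2 j eC hA hB ins|A y B P2 j eC hA xy hB ins].
- exact: TabAppend.
- have e : nil_eq (rd P ++ [:: x]) ((rd (behead P) ++ [:: x.+1]) ++ head [::] P).
    by rewrite eP -catA; apply: nil_eq_cat => //; rewrite eC; apply: nil_eq_skip.
  have red' : reduced (rd (behead P) ++ [:: x.+1]).
    by move: red; rewrite (reduced_eq e) => /reduced_prefix.
  exact: (TabSkip eC hA hB ins red' e).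
- have e : nil_eq (rd P ++ [:: x]) ((rd (behead P) ++ [:: y]) ++ A ++ x :: B).
    by rewrite eP -catA; apply: nil_eq_cat => //; rewrite eC; apply: nil_eq_bump.
  have red' : reduced (rd (behead P) ++ [:: y]).
    by move: red; rewrite (reduced_eq e) => /reduced_prefix.
  exact: (TabBump eC hA xy hB ins red' e).
Qed.

Lemma insert_nil_eq x P : tab P -> reduced (rd P ++ [:: x]) ->
  nil_eq (rd P ++ [:: x]) (rd (insert x P).1).
Proof.
elim: P x => [|C P1 IH] x tP red; first by [].
case: (tab_insertP tP red) (tab_behead tP) => [hC|A B P2 j|A y B P2 j].
- by move=> _ /=; rewrite -catA cats1.
- move=> _ _ _ ins red' e tP1; apply: nil_eq_trans e _; apply: nil_eq_cat => //.
  by have := IH _ tP1 red'; rewrite ins.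
- move=> _ _ _ _ ins red' e tP1; apply: nil_eq_trans e _; apply: nil_eq_cat => //.
  by have := IH _ tP1 red'; rewrite ins.
Qed.

Lemma count_mono (C : seq nat) u v : u <= v ->
  count (fun z => z <= u) C <= count (fun z => z <= v) C.
Proof. by move=> h; apply: sub_count => z /= hz; exact: leq_trans hz h. Qed.

Lemma count_all_lt (A : seq nat) x v : all (fun z => z < x) A -> x <= v ->
  count (fun z => z < v) A = size A.
Proof.
by move=> hA h; apply/eqP; rewrite -all_count; apply: sub_all hA => z hz; exact: leq_trans hz h.
Qed.

Lemma count_all_gt (B : seq nat) y v : all (fun z => y < z) B -> v <= y.+1 ->
  count (fun z => z < v) B = 0.
Proof.
move=> hB h; apply/eqP; rewrite -leqn0 leqNgt -has_count -all_predC.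
by apply: sub_all hB => z /= hz; rewrite -leqNgt; exact: leq_trans h hz.
Qed.

Lemma count_leE (A : seq nat) v : count (fun z => z <= v) A = count (fun z => z < v.+1) A.
Proof. by []. Qed.

(** The effect of inserting [y] on the next column, from [E] to [E'], in terms of the counts that
    define [dom]. [ic_pred] is for a skip in the column before; [ic_mem] and [ic_succ] are for
    reverse insertion. *)
Record insert_counts y (E E' : seq nat) : Prop := InsertCounts {
  ic_mem : y \in E';
  ic_below v : v < y -> count (fun z => z <= v) E' = count (fun z => z <= v) E;
  ic_mono v : count (fun z => z <= v) E <= count (fun z => z <= v) E';
  ic_above v : y <= v -> count (fun z => z <= v) E' <=
    maxn (count (fun z => z <= v) E) (count (fun z => z <= y) E).+1;
  ic_pred x : y = x.+1 -> count (fun z => z <= y) E' <= (count (fun z => z <= x) E).+1;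
  ic_succ : (count (fun z => z <= y) E).+1 <= count (fun z => z <= y.+1) E' }.

Lemma tab_insert_counts y P : tab P -> reduced (rd P ++ [:: y]) ->
  insert_counts y (head [::] P) (head [::] (insert y P).1).
Proof.
move=> tP red; case: (tab_insertP tP red) => [hC|A B P2 j -> hA hB _ _ _|A z B P2 j -> hA yz hB _ _ _] /=.
- split; rewrite ?mem_rcons ?inE ?eqxx //.
  + by move=> v h; rewrite -cats1 count_cat /=; lia.
  + by move=> v; rewrite -cats1 count_cat leq_addr.
  + by move=> v h; rewrite -cats1 count_cat /= !count_leE !(count_all_lt hC) //; lia.
  + by move=> x e; subst y; rewrite -cats1 count_cat /= !count_leE !(count_all_lt hC) //; lia.
  + by rewrite -cats1 count_cat /= !count_leE !(count_all_lt hC) //; lia.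
- split; rewrite ?mem_cat ?inE ?eqxx ?orbT //.
  + by move=> v h; lia.
  + by move=> x e; subst y; rewrite !count_cat /= !count_leE !(count_all_lt hA) ?(count_all_gt hB) //; lia.
  + by rewrite !count_cat /= !count_leE !(count_all_lt hA) ?(count_all_gt hB) //; lia.
- split; rewrite ?mem_cat ?inE ?eqxx ?orbT //.
  + by move=> v h; rewrite !count_cat /=; lia.
  + by move=> v; rewrite !count_cat /=; lia.
  + move=> v h; rewrite !count_cat /= !count_leE !(count_all_lt hA) //; try lia.
    case: (leqP z v) => hv; first by lia.
    by rewrite !(count_all_gt hB) //; lia.
  + by move=> x e; subst y; rewrite !count_cat /= !count_leE !(count_all_lt hA) ?(count_all_gt hB) //; lia.
  + by rewrite !count_cat /= !count_leE !(count_all_lt hA) ?(count_all_gt hB) //; lia.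
Qed.

(** At [v = x.+1] the bound [ic_above] would be too large by one; [ic_pred], with dominance at [x],
    gives the required [size A + 1]. *)
Lemma dom_skip A x B E E' : all (fun z => z < x) A -> all (fun z => x.+1 < z) B ->
  dom (A ++ [:: x, x.+1 & B]) E -> insert_counts x.+1 E E' -> dom (A ++ [:: x, x.+1 & B]) E'.
Proof.
move=> hA hB hd [_ h1 _ h2 h3 _] v; have := hd v; have := hd x; have := hd x.+1.
have b0 : count (fun z => z < x) B = 0 by apply: count_all_gt hB _; lia.
have b1 : count (fun z => z < x.+1) B = 0 by apply: count_all_gt hB _; lia.
have a0 u : x <= u -> count (fun z => z < u) A = size A by exact: count_all_lt.
rewrite !count_cat /= b0 b1.
have [hv|hv|->] := ltngtP v x.+1; first by rewrite h1.
  by have := h2 v (ltnW hv); rewrite !a0; lia.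
by have := h3 x erefl; rewrite !a0; lia.
Qed.

(** Below [y] the counts in [E] do not change and those on the left do not drop. From [y] on, at
    most one more than the old count at [y] is needed, which was at most [size A], and [x] supplies
    the extra one. *)
Lemma dom_bump A x y B E E' : all (fun z => z < x) A -> x < y -> all (fun z => y < z) B ->
  dom (A ++ y :: B) E -> insert_counts y E E' -> dom (A ++ x :: B) E'.
Proof.
move=> hA xy hB hd [_ h1 _ h2 _ _] v; have := hd v; have := hd y.
have b0 : count (fun z => z < y) B = 0 by apply: count_all_gt hB _; lia.
have a0 u : x <= u -> count (fun z => z < u) A = size A by exact: count_all_lt.
rewrite !count_cat /= b0.
have [hv|hv] := ltnP v y; first by rewrite h1 //; lia.
by have := h2 v hv; rewrite !a0; lia.
Qed.

Lemma tab_insert x P : tab P -> reduced (rd P ++ [:: x]) -> tab (insert x P).1.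
Proof.
elim: P x => [|C P1 IH] x tP red; first by rewrite /=; split=> // v.
have tP1 := tab_behead tP; case: (tab_insertP tP red) (tP) (red) => [/= hC|A B P2 j /=|A y B P2 j /=].
- case=> [C0 sC dC _] _; split=> //; first by rewrite -size_eq0 size_rcons.
    by rewrite -cats1 sorted_ltn_cat sC hC.
  by move=> v; rewrite -cats1 count_cat; apply: leq_trans (dC v) (leq_addr _ _).
- move=> eC hA hB ins red' _ [C0 sC dC _] _; have := IH _ tP1 red'.
  have := tab_insert_counts tP1 red'; rewrite ins /= => ic tP2; split=> //.
  by move: dC; rewrite eC => dC; apply: dom_skip ic.
- move=> eC hA xy hB ins red' _ [C0 sC dC _] _; have := IH _ tP1 red'.
  have := tab_insert_counts tP1 red'; rewrite ins /= => ic tP2; split=> //.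
  + by case: A {hA eC}.
  + move: sC; rewrite eC !sorted_ltn_cat => /and4P[-> _ _ ->]; rewrite hA /= andbT.
    by apply: sub_all hB => z; exact: ltn_trans.
  + by move: dC; rewrite eC => dC; apply: dom_bump ic.
Qed.

(** Skip and bump in one form, with exactly the order facts needed to compare two consecutive
    insertions. *)
Lemma insert_cases x P : tab P -> reduced (rd P ++ [:: x]) ->
  (all (fun z => z < x) (head [::] P) /\ insert x P = (rcons (head [::] P) x :: behead P, 0)) \/
  exists y C' P2 j, [/\ insert x P = (C' :: P2, j.+1), insert y (behead P) = (P2, j),
    reduced (rd (behead P) ++ [:: y]), x < y & [/\ x \in C', y \in head [::] P,
    forall z, z \in head [::] P -> x < z -> y <= z & forall z, z \in C' -> x.+1 < z -> y < z]].
Proof.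
move=> tP red; case: (tab_insertP tP red) => [hC|A B P2 j|A y B P2 j]; first by left.
- move=> eC hA hB ins red' _; right; exists x.+1, (head [::] P), P2, j.
  by split=> //; split; rewrite // eC mem_cat !inE eqxx ?orbT.
- move=> eC hA xy hB ins red' _; right; exists y, (A ++ x :: B), P2, j.
  split=> //; split; rewrite ?eC ?mem_cat ?inE ?eqxx ?orbT // => z;
    rewrite mem_cat inE => /or3P[/(allP hA)|/eqP->|/(allP hB)] /=; lia.
Qed.

Lemma reduced_insert2 y y' P P2 j : tab P -> reduced (rd P ++ [:: y]) -> insert y P = (P2, j) ->
  reduced (rd P2 ++ [:: y']) = reduced (rd P ++ [:: y; y']).
Proof.
move=> tP red ins; have := insert_nil_eq tP red; rewrite ins => e.
by rewrite -(reduced_eq (nil_eq_cat e (@nil_eq_refl [:: y']))) -catA.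
Qed.

Lemma reduced_pairl P (x x' : nat) : reduced (rd P ++ [:: x; x']) -> reduced (rd P ++ [:: x]).
Proof. by rewrite -[[:: x; x']]/([:: x] ++ [:: x']) catA => /reduced_prefix. Qed.

(** The bumped letters stay in order: the second, [y'], exceeds [x' > x], hence exceeds [x.+1], and
    the entries of the changed column beyond [x.+1] are all larger than [y]. So the second path ends
    no later than the first. *)
Lemma insert_increasing x x' P : tab P -> reduced (rd P ++ [:: x; x']) -> x < x' ->
  (insert x' (insert x P).1).2 <= (insert x P).2.
Proof.
elim: P x x' => [|C P1 IH] x x' tP red xx'.
  by rewrite /= (leq_gtF (ltnW xx')).
have red1 := reduced_pairl red.
case: (insert_cases tP red1) => [[hC ->]|].
  rewrite insert_appendE // all_rcons xx'.
  by apply: sub_all hC => z h; exact: ltn_trans h xx'.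
case=> y [C' [P2 [j [ins ins1 red' xy [xC' yC h1 h2]]]]].
have := red; rewrite -(reduced_insert2 _ tP red1 ins) ins [_.1]/= => red2.
have := tab_insert tP red1; rewrite ins => tP'.
case: (insert_cases tP' red2) => [[_ ->] //|].
case=> y' [C'' [P3 [j' [-> ins2 red'' xy' [_ y'C _ _]]]]].
rewrite /= ltnS; have := IH y y' (tab_behead tP); rewrite [behead _]/= in ins1 ins2 red' red''.
rewrite -(reduced_insert2 _ (tab_behead tP) red' ins1) ins1 /= ins2 /=; apply=> //.
by apply: h2 => //; exact: leq_ltn_trans xx' xy'.
Qed.

(** After the first insertion [x] is in the column, so [x'] cannot stop there and bumps some
    [y' <= x < y]. The order is inherited by the next column, and the second path must outlast the
    first. *)
Lemma insert_decreasing x x' P : tab P -> reduced (rd P ++ [:: x; x']) -> x' < x ->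
  (insert x P).2 < (insert x' (insert x P).1).2.
Proof.
elim: P x x' => [|C P1 IH] x x' tP red xx'.
  by rewrite /= xx' /smallest_larger /= xx' inE (ltn_eqF xx') andbF.
have red1 := reduced_pairl red.
have := red; case: (insert_cases tP red1) => [[hC ins]|].
  rewrite -(reduced_insert2 _ tP red1 ins) ins [_.1]/= [_.2]/= => red2.
  have := tab_insert tP red1; rewrite ins => tP'.
  case: (insert_cases tP' red2) => [[/= h _]|]; last by case=> y [C' [P2 [j [-> _ _ _ _]]]].
  by move: h; rewrite all_rcons => /andP[/= h _]; lia.
case=> y [C' [P2 [j [ins ins1 red' xy [xC' yC h1 h2]]]]].
rewrite -(reduced_insert2 _ tP red1 ins) ins [_.1]/= => red2.
have := tab_insert tP red1; rewrite ins => tP'.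
case: (insert_cases tP' red2) => [[/= h _]|].
  by move/allP: h => /(_ _ xC') /=; lia.
case=> y' [C'' [P3 [j' [-> ins2 red'' xy' [_ y'C h3 _]]]]].
rewrite /= ltnS; have := IH y y' (tab_behead tP); rewrite [behead _]/= in ins1 ins2 red' red''.
rewrite -(reduced_insert2 _ (tab_behead tP) red' ins1) ins1 /= ins2 /=; apply=> //.
by apply: leq_ltn_trans xy; apply: h3.
Qed.

Lemma tab_sizes P c : tab P -> size (nth [::] P c.+1) <= size (nth [::] P c).
Proof.
elim: P c => [|C P1 IH] c tP; first by rewrite !nth_nil.
case: c => [|c] /=; last exact: IH (tab_behead tP).
(* The sum of the entries of [E] serves as a value that no entry exceeds, so that [dom] compares
   full lengths. *)
rewrite nth0; set E := head _ _; case: tP => _ _ /(_ (\sum_(z <- E) z)) + _.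
rewrite (@eq_in_count _ _ predT E) ?count_predT.
  by move=> h; apply: leq_trans h (count_size _ _).
by move=> z zE /=; rewrite (big_rem z) //= leq_addr.
Qed.

Lemma size_insert x P : map size (insert x P).1 = incr_nth (map size P) (insert x P).2.
Proof.
elim: P x => //= C P1 IH x; case: ifP => h /=; last by rewrite size_rcons.
case: ifP => _; first by have := IH x.+1; case: insert => P2 j /= ->.
have := IH (smallest_larger x C); case: insert => P2 j /= ->.
congr (_ :: _); rewrite size_set_nth; apply/maxn_idPr; rewrite index_mem.
rewrite /smallest_larger; set D := sort _ _.
have : has (fun z => z \in D) D by case eD : D => [|d D'] /=; rewrite ?inE ?eqxx //;
  move: h; rewrite has_filter -size_eq0 -(size_sort leq) -/D eD.
case eD : D => [//|d D'] _ /=; have : d \in D by rewrite eD inE eqxx.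
by rewrite mem_sort mem_filter => /andP[].
Qed.

(* The bumping path moves weakly up, so the new box is at most as low as the slot of the inserted letter in the first column. *)
Lemma insert_row x P : tab P -> reduced (rd P ++ [:: x]) ->
  size (nth [::] P (insert x P).2) <= count (fun z => z < x) (head [::] P).
Proof.
elim: P x => [|C P1 IH] x tP red //.
case: (tab_insertP tP red) (tab_behead tP) (tP) => [/= hC|A B P2 j /=|A y B P2 j /=].
- by move=> _ _; rewrite (count_all_lt hC) ?leqnn.
- move=> eC hA hB ins red' _ tP1 [_ _ dC _]; have := IH _ tP1 red'; rewrite ins /=.
  by move/leq_trans; apply; exact: dC.
- move=> eC hA xy hB ins red' _ tP1 [_ _ dC _]; have := IH _ tP1 red'; rewrite ins /=.
  move/leq_trans; apply; apply: leq_trans (_ : count (fun z => z <= y) (head [::] P1) <= _).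
    by apply: sub_count => z; exact: ltnW.
  apply: leq_trans (dC y) _; rewrite eC !count_cat /=.
  have -> : count (fun z => z < y) B = 0 by apply: count_all_gt hB _; lia.
  have -> : count (fun z => z < x) A = size A by apply: count_all_lt hA _.
  have -> : count (fun z => z < y) A = size A by apply: count_all_lt hA _; lia.
  lia.
Qed.

(** A letter passed to the next column is larger than the one that arrived, so the letter arriving
    in column [c], counted from 0, is at least [x + c]; a changed entry is such a letter. *)
Lemma insert_entries x P c i : tab P -> reduced (rd P ++ [:: x]) ->
  i < size (nth [::] (insert x P).1 c) ->
  (i < size (nth [::] P c) /\ nth 0 (nth [::] (insert x P).1 c) i = nth 0 (nth [::] P c) i) \/
  x + c <= nth 0 (nth [::] (insert x P).1 c) i.
Proof.
elim: P x c => [|C P1 IH] x c tP red.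
  by case: c i => [|[]] [] //= _; right; rewrite addn0.
case: (tab_insertP tP red) (tab_behead tP) => [/= hC|A B P2 j /=|A y B P2 j /=].
- move=> _; case: c => [|c] /=; last by left.
  rewrite size_rcons ltnS leq_eqVlt nth_rcons => /orP[/eqP->|->]; last by left.
  by rewrite ltnn eqxx addn0; right.
- move=> eC hA hB ins red' _ tP1; case: c => [|c] /=; first by left.
  by have := IH _ c tP1 red'; rewrite ins /= => h /h[|h']; [left|right; rewrite addnS].
- move=> eC hA xy hB ins red' _ tP1; case: c => [|c] /=.
    rewrite eC !size_cat /= !nth_cat => hi; rewrite hi.
    case: (ltnP i (size A)) => hA'; first by left.
    by case: (i - size A) => [|t] /=; [right; rewrite addn0|left].
  by have := IH _ c tP1 red'; rewrite ins /= => h /h[|h']; [left|right; apply: leq_trans h'; rewrite addnS ltn_add2r].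
Qed.

(** * Reverse insertion *)

Lemma tab_nil P : tab P -> head [::] P = [::] -> P = [::].
Proof. by case: P => [|C P1] //= [+ _ _ _] e; rewrite e. Qed.

Lemma tab_ext P P' : tab P -> tab P' -> head [::] P = head [::] P' ->
  behead P = behead P' -> P = P'.
Proof.
case: P P' => [|C P1] [|C' P1'] //= t t' e e'.
- by case: t'; rewrite -e.
- by case: t; rewrite e.
- by rewrite e e'.
Qed.

(** By induction the letter [y] passed on is known. After a skip it is still in the column, after a
    bump it is not, so the two cases cannot be confused; for a bump, [x] is the largest entry below
    [y], which [uniqS] expresses. *)
Lemma insert_inj x x' P P' : tab P -> tab P' -> reduced (rd P ++ [:: x]) ->
  reduced (rd P' ++ [:: x']) -> insert x P = insert x' P' -> x = x' /\ P = P'.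
Proof.
elim: P x x' P' => [|C P1 IH] x x' P' tP tP' red red' e.
  move: e; case: (tab_insertP tP' red') => //= _ [e1 e2].
  have e0 : head [::] P' = [::] by case: (head _ _) e1 => // a [].
  by move: e1; rewrite e0 /= => -[->]; rewrite (tab_nil tP' e0).
have uniqS D D' (y z z' : nat) D2 D2' : all (fun t => t < z) D -> z < y -> all (fun t => y < t) D2 ->
    all (fun t => t < z') D' -> z' < y -> all (fun t => y < t) D2' ->
    D ++ z :: D2 = D' ++ z' :: D2' -> [/\ D = D', z = z' & D2 = D2'].
  move=> hD zy hD2 hD' zy' hD2' eD.
  have filt U (u : nat) V : all (fun t => t < u) U -> u < y -> all (fun t => y < t) V ->
      [seq t <- U ++ u :: V | t < y] = rcons U u.
    move=> hU uy hV; rewrite filter_cat /= uy (all_filterP _); last first.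
      by apply: sub_all hU => t h; exact: ltn_trans h uy.
    rewrite -cats1; congr (_ ++ (_ :: _)); apply/eqP.
    by rewrite -[_ == _]negbK -has_filter -all_predC; apply: sub_all hV => t /=; lia.
  have := filt _ _ _ hD zy hD2; rewrite eD filt // => /rcons_inj [e1 e2].
  by subst D' z'; move/eqP: eD; rewrite eqseq_cat // => /andP[_ /eqP[]] ->.
move: e (tab_behead tP) (tab_behead tP').
case: (tab_insertP tP red) => [/= hC|A B P2 j /=|A y B P2 j /=];
  case: (tab_insertP tP' red') => [/= hC'|A' B' P2' j' /=|A' y' B' P2' j' /=] //=.
- move=> [+ e2] t1 t2; case/rcons_inj => e1 ->; split=> //.
  exact: tab_ext.
- move=> eC' hA' hB' ins' r' _ eC hA hB ins r _ [e1 e2 e3] t1 t2; subst P2' j'.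
  have [[->] eb] := IH _ _ _ t1 t2 r r' (etrans ins (esym ins')); split=> //.
  exact: tab_ext.
- move=> eC' hA' xy' hB' ins' r' _ eC hA hB ins r _ [e1 e2 e3] t1 t2; subst P2' j'.
  have [ey eb] := IH _ _ _ t1 t2 r r' (etrans ins (esym ins')); subst y'.
  have : x.+1 \in C by rewrite eC mem_cat !inE eqxx !orbT.
  rewrite e1 mem_cat inE => /or3P[/(allP hA')|/eqP|/(allP hB')] /=; lia.
- move=> eC' hA' hB' ins' r' _ eC hA xy hB ins r _ [e1 e2 e3] t1 t2; subst P2' j'.
  have [ey eb] := IH _ _ _ t1 t2 r r' (etrans ins (esym ins')); subst y.
  have : x'.+1 \in head [::] P' by rewrite eC' mem_cat !inE eqxx !orbT.
  rewrite -e1 mem_cat inE => /or3P[/(allP hA)|/eqP|/(allP hB)] /=; lia.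
- move=> eC' hA' xy' hB' ins' r' _ eC hA xy hB ins r _ [e1 e2 e3] t1 t2; subst P2' j'.
  have [ey eb] := IH _ _ _ t1 t2 r r' (etrans ins (esym ins')); subst y'.
  have [eA ex eB] := uniqS _ _ _ _ _ _ _ hA xy hB hA' xy' hB' e1.
  by subst; split=> //; apply: tab_ext; rewrite ?eC'.
Qed.

Lemma dom_unbump A x y B E E' : all (fun z => z < x) A -> x < y -> all (fun z => y < z) B ->
  insert_counts y E E' -> dom (A ++ x :: B) E' -> dom (A ++ y :: B) E.
Proof.
move=> hA xy hB ic hd v; have := hd v; have := ic_mono ic v; have := hd y.+1; have := ic_succ ic.
rewrite !count_cat /=.
have -> : count (fun z => z < y.+1) B = 0 by apply: count_all_gt hB _; lia.
have -> : count (fun z => z < y.+1) A = size A by apply: count_all_lt hA _; lia.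
have [hv|hv] := ltnP y v; first by lia.
have := count_mono E hv.
have [hx|hx] := ltnP x v; last by lia.
have -> : count (fun z => z < v) A = size A by apply: count_all_lt hA _; lia.
by lia.
Qed.

(** The columns on the right expel a letter [y]. If [y] already occurs in the current column, the
    step was a skip by [y - 1]; otherwise it was a bump, undone by putting [y] in place of the
    largest entry below it. *)
Lemma uninsert P' j : tab P' -> reduced (rd P') -> j < size P' ->
  size (nth [::] P' j.+1) < size (nth [::] P' j) ->
  exists x P, [/\ tab P, nil_eq (rd P') (rd P ++ [:: x]) & insert x P = (P', j)].
Proof.
elim: P' j => [//|C' P1' IH] [|j] tP' red hj.
  rewrite /= nth0; case: (tP'); case/lastP: C' tP' red hj => // C x tP' red hj _ sC dC t1.
  rewrite size_rcons ltnS => hs.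
  have hC : all (fun z => z < x) C.
    by move: sC; rewrite -cats1 sorted_ltn_cat => /and4P[].
  have [C0|C0] := eqVneq C [::].
    subst C; move: hs; rewrite leqn0 => /eqP/size0nil h.
    by rewrite (tab_nil t1 h); exists x, [::].
  exists x, (C :: P1'); split; rewrite ?insert_appendE //=; last by rewrite -catA cats1.
  split=> //; first by move: sC; rewrite -cats1 sorted_ltn_cat => /and4P[].
  move=> v; have := dC v; rewrite -cats1 count_cat /=.
  have [hv|hv] := ltnP x v; last by lia.
  rewrite (count_all_lt hC) ?(ltnW hv) // => _.
  by apply: leq_trans hs; apply: count_size.
have [_ sC dC t1] := tP'; move: red => /= red hs.
have [y [P1 [tP1 e ins]]] := IH j t1 (reduced_prefix red) hj hs.
have e' : nil_eq (rd P1' ++ C') (rd P1 ++ y :: C').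
  by rewrite -[_ ++ y :: _]cat_rcons -cats1; apply: nil_eq_cat.
have redy : reduced (rd P1 ++ [:: y]).
  by rewrite -(reduced_eq e); exact: reduced_prefix red.
have ic := tab_insert_counts tP1 redy; rewrite ins [_.1]/= in ic.
have [yC|yC] := boolP (y \in C').
  have sp := sorted_split y sC; set A := filter _ _ in sp; set D := filter _ _ in sp.
  have hA : all (fun z => z < y) A by exact: filter_all.
  have yD : y \in D by rewrite mem_filter leqnn.
  have eD : exists B, D = y :: B /\ all (fun z => y < z) B.
    have sD : sorted ltn D by apply: sorted_filter => //; exact: ltn_trans.
    have gD : all (fun z => y <= z) D by exact: filter_all.
    case: D yD sD gD {sp} => // d B; rewrite inE /= => h hB /andP[dy gB].
    have hdB := order_path_min ltn_trans hB.
    by case/orP: h => [/eqP ed|/(allP hdB) /=]; [subst d; exists B|lia].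
  case: eD => B [eD hB]; rewrite eD in sp.
  (* If [y - 1] were missing, the expelled [y] would commute past [A] to the [y] in the column,
     against reducedness. *)
  have far_no : ~~ all (far y) A.
    apply/negP => hf; move: red; rewrite (reduced_eq e') sp -cat_cons -cat_rcons.
    by rewrite rcons_cons catA => /reduced_prefix; rewrite reduced_farsq.
  have [x ex xA] : exists2 x, y = x.+1 & x \in A.
    case/allPn: far_no => x xA; rewrite /far => hx; exists x => //.
    by have := allP hA x xA; move: hx => /=; lia.
  subst y; have sA : sorted ltn A by apply: sorted_filter => //; exact: ltn_trans.
  have eA : exists A', A = rcons A' x /\ all (fun z => z < x) A'.
    case/splitPr: xA hA sA {sp far_no} => A1 A2; rewrite all_cat /= sorted_ltn_cat.
    move=> /and3P[_ _ h2] /and4P[_ h1 h3 _].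
    exists A1; split=> //; case: A2 h2 h3 => [|a A2] /=; first by rewrite cats1.
    by move=> /andP[? _] /andP[? _]; lia.
  case: eA => A' [eA hA']; rewrite eA cat_rcons in sp.
  exists x, (C' :: P1); split.
  - by split=> //; [case: (tP')|move=> v; apply: leq_trans (ic_mono ic v) (dC v)].
  - apply: nil_eq_trans e' _ => /=; rewrite -catA cats1; apply: nil_eq_cat => //.
    by apply: nil_eq_sym; rewrite sp; apply: nil_eq_skip.
  - by move: sC; rewrite sp => sC; rewrite insert_skipE // ins.
(* The next column contains [y] by [ic_mem], so dominance provides an entry of [C'] below [y]. *)
have hy : has (fun z => z < y) C'.
  rewrite has_count; apply: leq_trans (dC y); rewrite -has_count.
  by apply/hasP; exists y => //; exact: ic_mem ic.
have [A [x [B [eC xy hB]]]] := last_below sC yC hy.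
have hA : all (fun z => z < x) A.
  by move: sC; rewrite eC sorted_ltn_cat => /and4P[].
exists x, ((A ++ y :: B) :: P1); split.
- split; [by case: (A)| |by apply: (dom_unbump hA xy hB ic); rewrite -eC|by []].
  move: sC; rewrite eC !sorted_ltn_cat => /and4P[-> _ _ ->]; rewrite hB /= andbT.
  by apply: sub_all hA => z h; exact: ltn_trans h xy.
- apply: nil_eq_trans e' _ => /=; rewrite -catA cats1; apply: nil_eq_cat => //.
  by apply: nil_eq_sym; rewrite eC; apply: nil_eq_bump.
- rewrite insert_bumpE //; first by rewrite ins eC.
  move: sC; rewrite eC !sorted_ltn_cat => /and4P[-> _ _ ->]; rewrite hB /= andbT.
  by apply: sub_all hA => z h; exact: ltn_trans h xy.
Qed.

(** * Biwords and recording tableaux *)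

Definition read_lt (p q : nat * nat) : bool :=
  (p.1 < q.1) || ((p.1 == q.1) && (q.2 < p.2)).

Definition semistd (Q : tableau) : Prop :=
  (forall c, sorted ltn (nth [::] Q c)) /\
  (forall c i, i < size (nth [::] Q c.+1) ->
     nth 0 (nth [::] Q c) i <= nth 0 (nth [::] Q c.+1) i).

(* The box recorded last by a biword in reading order. *)
Definition last_box (Q : tableau) (a j : nat) : Prop :=
  a \in nth [::] Q j /\
  forall c z, z \in nth [::] Q c -> (z < a) || ((z == a) && (c <= j)).

Lemma last_box_uniq Q a j a' j' : last_box Q a j -> last_box Q a' j' -> a = a' /\ j = j'.
Proof. by move=> [h1 h2] [h1' h2']; have := h2 _ _ h1'; have := h2' _ _ h1; lia. Qed.

Lemma nth_sizes (Q : tableau) c : nth 0 (map size Q) c = size (nth [::] Q c).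
Proof.
have [h|h] := ltnP c (size Q); first exact: nth_map.
by rewrite !nth_default // size_map.
Qed.

Lemma nth_record a j Q c :
  nth [::] (record a j Q) c = if c == j then rcons (nth [::] Q j) a else nth [::] Q c.
Proof. exact: nth_set_nth. Qed.

Lemma size_record a j Q : map size (record a j Q) = incr_nth (map size Q) j.
Proof.
rewrite /record; elim: Q j => [|C Q IH] [|j] //=; rewrite ?size_rcons //.
  by congr (_ :: _); elim: j => //= j ->.
by rewrite IH.
Qed.

Lemma record_inj a j Q Q' : map size Q = map size Q' -> record a j Q = record a j Q' -> Q = Q'.
Proof.
move=> hs e; have hz : size Q = size Q' by rewrite -(size_map size Q) hs size_map.
apply: (@eq_from_nth _ [::]) => // c _.
have := nth_record a j Q c; rewrite e nth_record.
by case: eqP => [-> /rcons_inj[]|].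
Qed.

Lemma EG_rcons w p : EG (rcons w p) = EG_step (EG w) p.
Proof. exact: foldl_rcons. Qed.

(** [eg_entries], with columns counted from 0, becomes the flag condition once [P] is the full
    staircase. [eg_last] describes the final step in the form needed to undo it. *)
Record EG_spec (w : seq (nat * nat)) (P Q : tableau) : Prop := EGSpec {
  eg_tab : tab P;
  eg_word : nil_eq (map snd w) (rd P);
  eg_sizes : map size Q = map size P;
  eg_semistd : semistd Q;
  eg_entries c i : i < size (nth [::] Q c) ->
    nth 0 (nth [::] Q c) i + c <= nth 0 (nth [::] P c) i;
  eg_pos c z : z \in nth [::] Q c -> z \in map fst w;
  eg_last w0 a b : w = rcons w0 (a, b) ->
    [/\ tab (EG w0).1, nil_eq (map snd w) (rd (EG w0).1 ++ [:: b]),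
      (insert b (EG w0).1).1 = P & last_box Q a (insert b (EG w0).1).2] }.

Lemma EG_inv w : sorted read_lt w -> reduced (map snd w) -> all (fun p => p.1 <= p.2) w ->
  EG_spec w (EG w).1 (EG w).2.
Proof.
elim/last_ind: w => [|w [a b] IH] sw red hw.
  by split=> //; [split=> [c|c i]; rewrite !nth_nil|move=> c i; rewrite nth_nil
                |move=> c z; rewrite nth_nil|case].
move: red; rewrite map_rcons -cats1 /= => red.
move: hw; rewrite all_rcons /= => /andP[ab hw].
have sw' : sorted read_lt w by move: sw; rewrite -cats1 => /cat_sorted2[].
have [] := IH sw' (reduced_prefix red) hw; rewrite EG_rcons.
case eW : (EG w) => [P Q] /= tP nP sP [cQ rQ] eQ pQ lQ.
have nPb := nil_eq_cat nP (@nil_eq_refl [:: b]).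
have redb : reduced (rd P ++ [:: b]) by rewrite -(reduced_eq nPb).
have := tab_insert tP redb; have := insert_nil_eq tP redb; have := size_insert b P.
have hE c i := @insert_entries b P c i tP redb.
case eI : (insert b P) hE => [P' j] /= hE hS hN tP'; rewrite /EG_step /= eI /=.
(* When the top letter repeats, the bottom letters decrease, so [insert_decreasing] puts the new box
   strictly to the right of the preceding one. *)
have hnew c z : z \in nth [::] Q c -> (z < a) || ((z == a) && (c < j)).
  case/lastP: w sw red eW lQ {IH sw' hw nP pQ nPb} => [|w [a' b']] sw red eW lQ.
    by move: eW => [_ <-]; rewrite nth_nil.
  have [tP0 nP0 eP0 [_ h]] := lQ _ _ _ erefl; move/h.
  have : read_lt (a', b') (a, b).
    by move: sw; rewrite -!cats1 -catA => /cat_sorted2[_] /= /andP[].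
  rewrite /read_lt /= => /orP[aa|/andP[/eqP aa bb]]; first by lia.
  suff : (insert b' (EG w).1).2 < j by lia.
  have red2 : reduced (rd (EG w).1 ++ [:: b'; b]).
    rewrite -[[:: b'; b]]/([:: b'] ++ [:: b]) catA.
    by rewrite -(reduced_eq (nil_eq_cat nP0 (@nil_eq_refl [:: b]))).
  by have := insert_decreasing tP0 red2 bb; rewrite eP0 eI.
have szQ c : size (nth [::] Q c) = size (nth [::] P c) by rewrite -!nth_sizes sP.
have szP' c : size (nth [::] P' c) = (j == c) + size (nth [::] P c).
  by rewrite -!nth_sizes hS nth_incr_nth.
have szQ' c : size (nth [::] (record a j Q) c) = size (nth [::] P' c).
  by rewrite -!nth_sizes size_record hS sP.
have le_a c z : z \in nth [::] (record a j Q) c -> (z < a) || ((z == a) && (c <= j)).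
  rewrite nth_record; case: eqP => [->|_ /hnew]; last by lia.
  by rewrite mem_rcons inE => /orP[/eqP->|/hnew]; lia.
split=> //.
- by rewrite map_rcons -cats1 /=; apply: nil_eq_trans nPb hN.
- by rewrite size_record sP hS.
- split=> [c|c i hi].
    rewrite nth_record; case: eqP => _ //.
    rewrite -cats1 sorted_ltn_cat cQ /= andbT; apply/allP => z /hnew /=; lia.
  have := tab_sizes c tP'; rewrite -!szQ' => hle.
  move: (hi); rewrite !nth_record.
  have [ec|nc] := eqVneq c.+1 j.
    rewrite -ec (ltn_eqF (ltnSn c)) size_rcons ltnS nth_rcons leq_eqVlt.
    case/orP=> [/eqP ei|hi']; last by rewrite hi'; exact: rQ.
    rewrite ei ltnn eqxx.
    have : nth 0 (nth [::] Q c) i \in nth [::] Q c.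
      apply: mem_nth; move: hle hi; rewrite !nth_record -ec eqxx (ltn_eqF (ltnSn c)).
      by rewrite size_rcons => hle; move/leq_trans; apply; apply: leq_trans hle _.
    by rewrite ei => /hnew; lia.
  case: eqP => [ec|_] hi'; last exact: rQ.
  rewrite nth_rcons -ec ifT; first exact: rQ.
  by apply: leq_trans hi' _; rewrite !szQ; exact: tab_sizes.
- move=> c i; rewrite szQ' => hi.
  case: (hE c i hi) => [[hi' ->]|hb].
    rewrite nth_record; case: eqP => [ec|_]; last by apply: eQ; rewrite szQ.
    by rewrite nth_rcons -ec szQ hi'; apply: eQ; rewrite szQ.
  (* A changed entry of [P] in column [c] is at least [b + c], while every recorded entry is at most
     [a <= b]. *)
  apply: leq_trans hb; rewrite leq_add2r; apply: leq_trans ab.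
  have := @mem_nth _ 0 (nth [::] (record a j Q) c) i; rewrite szQ' => /(_ hi)/le_a.
  by case/orP=> [/ltnW //|/andP[/eqP->]].
- move=> c z; rewrite nth_record map_rcons mem_rcons inE.
  case: eqP => [_|_ /pQ->]; last by rewrite orbT.
  by rewrite mem_rcons inE => /orP[->|/pQ->]; rewrite ?orbT.
- move=> w0 a0 b0 /rcons_inj[<- <- <-]; rewrite eW /= eI; split=> //.
    by rewrite map_rcons -cats1.
  by split; rewrite // nth_record eqxx mem_rcons inE eqxx.
Qed.

(** The last recorded box is determined by the recording tableau alone, so both words end with the
    same top letter and the same new column; [insert_inj] then recovers the bottom letter and the
    previous tableau. *)
Lemma EG_inj w w' : sorted read_lt w -> reduced (map snd w) -> all (fun p => p.1 <= p.2) w ->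
  sorted read_lt w' -> reduced (map snd w') -> all (fun p => p.1 <= p.2) w' ->
  EG w = EG w' -> w = w'.
Proof.
have notnil w0 p : (EG (rcons w0 p)).2 <> [::].
  rewrite EG_rcons; case: (EG w0) => P Q; rewrite /EG_step; case: insert => P' j /=.
  by move/(congr1 (map size)); rewrite size_record; case: (map _ _) j => [|? ?] [].
elim/last_ind: w w' => [|w [a b] IH] w'; case/lastP: w' => [|w' [a' b']] //.
- by move=> _ _ _ _ _ _ e; case: (@notnil w' (a', b')); rewrite -e.
- by move=> _ _ _ _ _ _ e; case: (@notnil w (a, b)); rewrite e.
move=> s r h s' r' h' e.
have [_ _ _ _ _ _ /(_ _ _ _ erefl)[t1 n1 i1 l1]] := EG_inv s r h.
have [_ _ _ _ _ _ /(_ _ _ _ erefl)[t2 n2 i2 l2]] := EG_inv s' r' h'.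
have [ea ej] := last_box_uniq l1 (eq_rect _ (fun Q => last_box Q a' _) l2 _ (congr1 snd (esym e))).
have red1 : reduced (rd (EG w).1 ++ [:: b]) by rewrite -(reduced_eq n1).
have red2 : reduced (rd (EG w').1 ++ [:: b']) by rewrite -(reduced_eq n2).
have [] := insert_inj t1 t2 red1 red2.
  by move: i1 i2 ej; rewrite e; case: insert => ? ?; case: insert => ? ? /= -> -> ->.
move=> eb eP; subst a' b'.
have sub u p : sorted read_lt (rcons u p) -> reduced (map snd (rcons u p)) ->
    all (fun q => q.1 <= q.2) (rcons u p) ->
    [/\ sorted read_lt u, reduced (map snd u) & all (fun q => q.1 <= q.2) u].
  rewrite all_rcons map_rcons -!cats1 => /cat_sorted2[-> _] /reduced_prefix -> /andP[_ ->].
  by [].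
have [sw rw hw] := sub _ _ s r h; have [sw' rw' hw'] := sub _ _ s' r' h'.
congr rcons; apply: IH => //.
have := eg_sizes (EG_inv sw rw hw); have := eg_sizes (EG_inv sw' rw' hw').
move: e; rewrite !EG_rcons -eP.
case: (EG w) eP => P Q /= ->; case: (EG w') => P' Q' /=; rewrite /EG_step /=.
case: insert => P2 j [e] s1 s2; congr (_, _); apply: record_inj e.
by rewrite s1 s2.
Qed.

Lemma max_elt (s : seq nat) : s != [::] -> exists2 a, a \in s & all (fun z => z <= a) s.
Proof.
elim: s => // b s IH _; have [->|/IH[a ha hs]] := eqVneq s [::].
  by exists b; rewrite ?inE //= leqnn.
exists (maxn a b); rewrite ?inE /=; first by rewrite /maxn; case: ltnP; rewrite ?eqxx ?ha ?orbT.
by rewrite leq_maxr; apply: sub_all hs => z hz; rewrite leq_max hz.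
Qed.

Lemma ex_last_box Q : flatten Q != [::] -> exists a j, last_box Q a j.
Proof.
case/max_elt=> a aQ hmax.
have ex : exists j, a \in nth [::] Q j.
  by case/flattenP: aQ => C CQ aC; exists (index C Q); rewrite nth_index.
have bd j : a \in nth [::] Q j -> j <= size Q.
  by move=> h; rewrite leqNgt; apply/negP => /ltnW hj; move: h; rewrite nth_default.
have [j hj hjmax] := ex_maxnP ex bd.
exists a, j; split=> // c z zc.
have : z <= a.
  apply: (allP hmax); apply/flattenP; exists (nth [::] Q c) => //; apply: mem_nth.
  by rewrite ltnNge; apply/negP => h; move: zc; rewrite nth_default.
by rewrite leq_eqVlt => /orP[/eqP ez|->] //; subst z; rewrite eqxx hjmax // orbT.
Qed.

Lemma count_lt_sorted (C : seq nat) lo x : sorted ltn C -> all (fun z => lo <= z) C ->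
  count (fun z => z < x) C <= x - lo.
Proof.
move=> sC hC; rewrite -size_filter -(size_iota lo (x - lo)); apply: uniq_leq_size.
  by apply: filter_uniq; apply: sorted_uniq sC; [exact: ltn_trans|exact: ltnn].
by move=> z; rewrite mem_filter mem_iota => /andP[hz /(allP hC)]; lia.
Qed.

Lemma sorted_rcons2 (T : Type) (e : rel T) s x y :
  sorted e (rcons (rcons s x) y) = sorted e (rcons s x) && e x y.
Proof. by case: s => [|z s] /=; rewrite ?andbT // !rcons_path last_rcons. Qed.

Lemma ltn_sumn_incr s j : sumn s < sumn (incr_nth s j).
Proof.
elim: s j => [|x s IH] [|j] //=; last by rewrite ltn_add2l.
by elim: j.
Qed.

(** The suffix [v] holds the letters already removed. It keeps [rd P ++ v] a reduced word of
    [wrev n k] throughout the induction on the number of boxes, so that [wrev_letters] still bounds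
    every letter. *)
Lemma EG_surj n k P Q v : 2 * k < n -> tab P ->
  nil_act (Some id) (rd P ++ v) = Some (wrev n k) -> map size Q = map size P -> semistd Q ->
  (forall c i, i < size (nth [::] Q c) -> 0 < nth 0 (nth [::] Q c) i <= i.+1 + k) ->
  exists w, [/\ EG w = (P, Q), sorted read_lt w, nil_eq (map snd w) (rd P)
    & all (fun p => 0 < p.1 <= p.2) w].
Proof.
move=> kn; have [N] := ubnP (sumn (map size Q)).
elim: N P Q v => // N IH P Q v ltN tP hv sP [cQ rQ] fQ.
have red : reduced (rd P).
  by apply: (@reduced_prefix _ v); rewrite /reduced hv.
have [Q0|Qn] := eqVneq (flatten Q) [::].
  have P0 : P = [::].
    move/(congr1 size): Q0; rewrite size_flatten /shape sP; case: P tP {hv sP red} => //= C P1 [+ _ _ _].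
    by rewrite -size_eq0; case: size.
  subst P; case: Q sP {ltN cQ rQ fQ Q0} => // _; exists [::]; split=> //.
have [a [j [aj lQ]]] := ex_last_box Qn.
have szQ c : size (nth [::] Q c) = size (nth [::] P c) by rewrite -!nth_sizes sP.
have szj : 0 < size (nth [::] Q j) by case: (nth _ _ _) aj.
have Qj : nth 0 (nth [::] Q j) (size (nth [::] Q j)).-1 = a.
  move: (cQ j) aj szj (lQ j); case/lastP: (nth [::] Q j) => // C z.
  rewrite -cats1 sorted_ltn_cat => /and4P[_ hC _ _] aj _ h.
  rewrite size_cat addn1 /= nth_cat ltnn subnn /=.
  move: aj; rewrite mem_cat inE => /orP[/(allP hC) /= az|/eqP //].
  have := h z; rewrite mem_cat inE eqxx orbT => /(_ isT); lia.
have jP : j < size P.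
  by rewrite ltnNge; apply/negP => hj; move: szj; rewrite szQ nth_default.
have corner : size (nth [::] P j.+1) < size (nth [::] P j).
  rewrite ltn_neqAle tab_sizes // andbT -!szQ; apply/negP => /eqP es.
  have hlt : (size (nth [::] Q j)).-1 < size (nth [::] Q j.+1) by rewrite es prednK.
  have := rQ _ _ hlt; rewrite Qj => ha.
  by have := lQ j.+1 _ (mem_nth 0 hlt); move: ha; set z := nth 0 _ _; lia.
have [x [P0 [tP0 eP ins]]] := uninsert tP red jP corner.
have redx : reduced (rd P0 ++ [:: x]) by rewrite -(reduced_eq eP).
have szP c : size (nth [::] P c) = (j == c) + size (nth [::] P0 c).
  by have := size_insert x P0; rewrite ins /= => e; rewrite -!nth_sizes e nth_incr_nth.
pose Q0 := mkseq (fun c => take (size (nth [::] P0 c)) (nth [::] Q c)) (size P0).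
have nQ0 c : nth [::] Q0 c = take (size (nth [::] P0 c)) (nth [::] Q c).
  have [h|h] := ltnP c (size P0); first by rewrite nth_mkseq.
  by rewrite [nth _ P0 c]nth_default // take0 nth_default // size_mkseq.
have szQ0 c : size (nth [::] Q0 c) = size (nth [::] P0 c).
  by rewrite nQ0 size_takel // szQ szP leq_addl.
have sP0 : map size Q0 = map size P0.
  apply: (@eq_from_nth _ 0); rewrite !size_map ?size_iota // => c _.
  by rewrite !nth_sizes.
have eQ : Q = record a j Q0.
  have e : map size (record a j Q0) = map size Q.
    by rewrite size_record sP0 sP; have := size_insert x P0; rewrite ins.
  apply: (@eq_from_nth _ [::]); first by rewrite -(size_map size) -e size_map.
  move=> c _; rewrite nth_record !nQ0; case: eqP => [->|/eqP nc].
    have es : (size (nth [::] Q j)).-1 = size (nth [::] P0 j) by rewrite szQ szP eqxx.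
    by rewrite -es -{1}Qj -take_nth ?take_size prednK // take_size.
  by rewrite take_oversize // szQ szP eq_sym (negbTE nc).
have i_lt c i : i < size (nth [::] Q0 c) -> i < size (nth [::] Q c).
  by rewrite szQ0 szQ szP => /leq_trans; apply; apply: leq_addl.
have n_eq c i : i < size (nth [::] Q0 c) -> nth 0 (nth [::] Q0 c) i = nth 0 (nth [::] Q c) i.
  by rewrite szQ0 nQ0 => hi; rewrite nth_take.
have hv0 : nil_act (Some id) (rd P0 ++ (x :: v)) = Some (wrev n k).
  by rewrite -hv -cat1s catA; apply: nil_eq_cat => //; apply: nil_eq_sym.
have [| |c i hi|w [eW sW nW hW]] := IH P0 Q0 (x :: v) _ tP0 hv0 sP0.
- move: ltN; rewrite ltnS; apply: leq_trans.
  by rewrite eQ size_record ltn_sumn_incr.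
- split=> [c|c i hi]; first by rewrite nQ0; apply: take_sorted.
  rewrite !n_eq //; last by rewrite szQ0; apply: leq_trans hi _; rewrite szQ0; apply: tab_sizes.
  exact: rQ (i_lt _ _ hi).
- by rewrite n_eq //; apply: fQ; apply: i_lt.
have eW' : EG (rcons w (a, x)) = (P, Q) by rewrite EG_rcons eW /EG_step /= ins eQ.
have letters b : b \in rd P0 ++ x :: v -> k < b < n - k by exact: wrev_letters.
have a_bd : 0 < a <= (size (nth [::] P0 j)).+1 + k.
  rewrite -{1 2}Qj; have -> : size (nth [::] P0 j) = (size (nth [::] Q j)).-1.
    by rewrite szQ szP eqxx.
  by apply: fQ; rewrite prednK.
(* The new box has as many boxes above it as its column had, at most the number of entries of the
   first column below [x]. These are distinct and at least [k.+1], so there are at most [x - k.+1]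
   of them, and the flag bound on [a] gives the claim. *)
have ax : a <= x.
  have := insert_row tP0 redx; rewrite ins /= => hrow.
  have hx : k < x < n - k by apply: letters; rewrite mem_cat inE eqxx orbT.
  have := @count_lt_sorted (head [::] P0) k.+1 x (tab_head tP0).
  have hl : all (fun z => k.+1 <= z) (head [::] P0).
    apply/allP => z hz; have /andP[//] : k < z < n - k.
    by apply: letters; rewrite mem_cat rd_head mem_cat hz orbT.
  by move/(_ hl); move: hrow a_bd; lia.
exists (rcons w (a, x)); suff sWx : sorted read_lt (rcons w (a, x)).
  split=> //; last by rewrite all_rcons hW /= ax !andbT; case/andP: a_bd.
  rewrite map_rcons -cats1 /=; apply: nil_eq_trans (nil_eq_sym eP).
  exact: nil_eq_cat.
have redw : reduced (map snd w) by rewrite (reduced_eq nW); exact: reduced_prefix redx.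
have hW' : all (fun p => p.1 <= p.2) w by apply: sub_all hW => p /andP[].
case/lastP: w sW nW hW hW' redw eW eW' => // w [a' x'] sW nW hW hW' redw eW _.
rewrite sorted_rcons2 sW /=.
have := EG_inv sW redw hW'; rewrite eW => -[_ _ _ _ _ _ /(_ _ _ _ erefl)].
case ins' : (insert x' (EG w).1) => [P1 j'] /= [tP1 nP1 eP1 [aj' _]]; subst P1.
have redx' : reduced (rd (EG w).1 ++ [:: x'; x]).
  rewrite -[[:: x'; x]]/([:: x'] ++ [:: x]) catA.
  rewrite -(reduced_eq (nil_eq_cat nP1 (@nil_eq_refl [:: x]))).
  by rewrite (reduced_eq (nil_eq_cat nW (@nil_eq_refl [:: x]))).
have aQ : a' \in nth [::] Q j' by move: aj'; rewrite nQ0; apply: mem_take.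
rewrite /read_lt /=; have := lQ _ _ aQ => /orP[->//|/andP[/eqP ea jj]].
(* With equal top letters, equal bottom letters contradict reducedness; increasing ones put both
   boxes in one column by [insert_increasing], against strict columns of [Q]. *)
rewrite ea eqxx ltnn /= ltnNge; apply/negP; rewrite leq_eqVlt => /orP[/eqP ex|xx].
  by move: redx'; rewrite ex (@reduced_farsq _ x [::]).
have := insert_increasing tP1 redx' xx; rewrite ins' /= ins /= => jj'.
have ej : j' = j by lia.
move: (cQ j) aj'; rewrite ej ea {1}eQ nth_record eqxx -cats1 sorted_ltn_cat.
by case/and4P=> _ h _ _ /(allP h) /=; rewrite ltnn.
Qed.

(** * Tableaux of maximal size *)

Lemma tab_lower C P lo : tab (C :: P) -> all (fun z => lo <= z) C ->
  all (fun z => lo < z) (rd P).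
Proof.
elim: P C lo => [//|E P IH] C lo [_ _ dC tE] hC /=.
have hE : all (fun z => lo < z) E.
  apply/allP => z zE; have : 0 < count (fun t => t < z) C.
    by apply: leq_trans (dC z); rewrite -has_count; apply/hasP; exists z.
  by rewrite -has_count => /hasP[t /(allP hC) /=]; lia.
by rewrite all_cat hE andbT; apply: sub_all (IH E lo.+1 tE hE) => z /ltnW.
Qed.

(** Each column further right loses the smallest remaining value, so the column lengths are at most
    [d], [d - 1], and so on; equality forces every column to be a full interval. *)
Lemma tab_max P lo d : tab P -> all (fun z => lo <= z < lo + d) (rd P) ->
  size (rd P) <= size (rd (rev_tab lo d)) /\
  (size (rd P) = size (rd (rev_tab lo d)) -> P = rev_tab lo d).
Proof.
elim: d lo P => [|d IH] lo [|C P] tP hP.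
- by [].
- by move: tP hP => /= [+ _ _ _]; rewrite all_cat; case: C => //= a C _; lia.
- by split=> //=; rewrite size_cat addnS.
have -> : rd (rev_tab lo d.+1) = rd (rev_tab lo.+1 d) ++ iota lo d.+1 by [].
have -> : rd (C :: P) = rd P ++ C by [].
move: hP; rewrite [rd _]/= all_cat => /andP[hP hC]; rewrite !size_cat.
have [C0 sC dC t1] := tP.
have hP' : all (fun z => lo.+1 <= z < lo.+1 + d) (rd P).
  have hl : all (fun z => lo <= z) C by apply: sub_all hC => z /andP[].
  apply/allP => z zP; have := allP (tab_lower tP hl) z zP.
  by have := allP hP z zP; rewrite /= addSnnS => /andP[_ ->] ->.
have [le1 eq1] := IH lo.+1 P t1 hP'.
have uC : uniq C by apply: sorted_uniq sC; [exact: ltn_trans|exact: ltnn].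
have sub : {subset C <= iota lo d.+1} by move=> z /(allP hC); rewrite mem_iota.
have le2 := uniq_leq_size uC sub; split; first exact: leq_add.
have add_eq a b a' b' : a <= a' -> b <= b' -> a + b = a' + b' -> a = a' /\ b = b' by lia.
move/(add_eq _ _ _ _ le1 le2) => [e1 e2].
rewrite (eq1 e1) -[rev_tab lo d.+1]/(iota lo d.+1 :: rev_tab lo.+1 d); congr (_ :: _); apply: (irr_sorted_eq ltn_trans ltnn sC) => //.
  exact: (iota_ltn_sorted lo d.+1).
by have [] := uniq_min_size uC sub; rewrite ?e2.
Qed.

Lemma tab_wrev n k P : 2 * k < n -> tab P -> nil_act (Some id) (rd P) = Some (wrev n k) ->
  P = rev_tab k.+1 (n - 2 * k).-1.
Proof.
move=> kn tP hP; have bd : all (fun z => k.+1 <= z < k.+1 + (n - 2 * k).-1) (rd P).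
  by apply/allP => b /(wrev_letters kn hP); lia.
apply: (proj2 (tab_max tP bd)).
exact: size_wrev_word kn hP (nil_act_wrev kn).
Qed.

Lemma tab_rev_tab lo d : tab (rev_tab lo d).
Proof.
elim: d lo => // d IH lo; split=> //; first exact: (iota_ltn_sorted lo d.+1).
have -> : head [::] (rev_tab lo.+1 d) = iota lo.+1 d by case: (d).
move=> v; rewrite -[lo.+1]add1n iotaDl count_map -[d.+1]addn1 iotaD count_cat.
exact: leq_addr.
Qed.

Lemma size_rev_tab lo d : map size (rev_tab lo d) = [seq d.+1 - j | j <- iota 1 d].
Proof.
elim: d lo => //= d IH lo; rewrite size_iota IH subn1; congr (_ :: _).
by rewrite (iotaDl 1 1 d) -map_comp; apply: eq_map => j /=; rewrite add1n.
Qed.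

Lemma nth_rev_tab lo d c i : c + i < d -> nth 0 (nth [::] (rev_tab lo d) c) i = lo + c + i.
Proof.
elim: d lo c => // d IH lo [|c] h; first by rewrite [nth [::] _ _]/= -/(iota lo d.+1) nth_iota ?addn0.
by rewrite /= IH // addSnnS.
Qed.

(** * Chains and rank functions *)

(* [maxchain F q r d] is the largest size of a north-east chain of boxes of F in the first r rows and the columns q - d + 1, ..., q. *)
Fixpoint maxchain (F : nat -> nat -> bool) (q r : nat) : nat -> nat :=
  match r with
  | 0 => fun _ => 0
  | r'.+1 => fix row d := match d with
    | 0 => 0
    | d'.+1 => maxn (maxn (maxchain F q r' d'.+1) (row d')) (maxchain F q r' d' + F r'.+1 (q - d'))
    end
  end.

Arguments maxchain : simpl never.

Lemma maxchain_r0 F q r : maxchain F q r 0 = 0. Proof. by case: r. Qed.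

Lemma maxchainSS F q r d : maxchain F q r.+1 d.+1 =
  maxn (maxn (maxchain F q r d.+1) (maxchain F q r.+1 d)) (maxchain F q r d + F r.+1 (q - d)).
Proof. by []. Qed.

Lemma maxchain_row F q r d : maxchain F q r d <= maxchain F q r.+1 d.
Proof. by case: d => [|d]; rewrite ?maxchain_r0 // maxchainSS; lia. Qed.

Lemma maxchain_col F q r d : maxchain F q r d <= maxchain F q r d.+1.
Proof. by case: r => [|r] //; rewrite maxchainSS; lia. Qed.

(** Increments are 0 or 1, which is why booleans in [front] lose nothing. *)
Lemma maxchain_step F q r d : maxchain F q r.+1 d <= (maxchain F q r d).+1 /\
  maxchain F q r d.+1 <= (maxchain F q r d).+1.
Proof.
elim: r d => [|r IH] d.
  split=> //; elim: d => // d; rewrite /maxchain /=; lia.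
have h1 e : maxchain F q r.+2 e <= (maxchain F q r.+1 e).+1.
  elim: e => [|e IHe]; rewrite ?maxchain_r0 // maxchainSS.
  have := maxchain_col F q r.+1 e; lia.
split=> //; rewrite maxchainSS; have [_] := IH d; have := maxchain_row F q r d; lia.
Qed.

Definition bool_step (t : nat -> bool) b := if t b && ~~ t b.+1 then swap t b else t.

(** If both values lie on the same side of [q], exchanging them is invisible; otherwise the 0-Hecke
    step sorts a true-false pair into false-true. *)
Lemma dem_threshold (s : nat -> nat) b q :
  (fun i => dem_step s b i <= q) = bool_step (fun i => s i <= q) b.
Proof.
apply: functional_extensionality => i; rewrite /dem_step /bool_step.
have [->|n1] := eqVneq i b.
  by case: ltnP; case: ifP; rewrite ?swapl; lia.
have [->|n2] := eqVneq i b.+1.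
  by case: ltnP; case: ifP; rewrite ?swapr; lia.
by case: ifP; case: ifP; rewrite ?swapE.
Qed.

(* Which positions hold a value at most q, once the boxes of the rows above r and those right of column c in row r are processed: before position r the exits of these rows, then the edges of the boundary between the processed boxes and the others. *)
Definition front F q r c : nat -> bool := fun i =>
  if i < r then (i == 0) || (maxchain F q i q != maxchain F q i.-1 q)
  else if i < r + c then
    maxchain F q r.-1 (q - (i - r)) == maxchain F q r.-1 (q - (i - r).+1)
  else if i == r + c then maxchain F q r (q - c) != maxchain F q r.-1 (q - c)
  else if i <= r + q then maxchain F q r (q - (i - r)).+1 == maxchain F q r (q - (i - r))
  else false.

Definition box_step (F : nat -> nat -> bool) (t : nat -> bool) (b : nat * nat) :=
  if F b.1 b.2 then t else bool_step t (b.1 + b.2).-1.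

Lemma front_init F q : front F q 1 q = (fun i => i <= q).
Proof.
apply: functional_extensionality => i; rewrite /front.
case: ltnP => [|i0]; first by case: i.
case: ltnP => h; first by rewrite eqxx; lia.
by rewrite subnn maxchain_r0 /=; do 2?case: ifP => //; lia.
Qed.

Lemma front_row F q r : front F q r.+1 0 = front F q r.+2 q.
Proof.
apply: functional_extensionality => i; rewrite /front addn0 subn0 subnn.
have [h|h|->] := ltngtP i r.+1.
- by rewrite (ltn_trans h (ltnSn _)).
- rewrite (leq_gtF h) maxchain_r0 /= !addSn.
  have [h2|h2] := ltnP i (r + q).+2.
    have -> : q - (i - r.+2) = (q - (i - r.+1)).+1 by lia.
    have -> : (i - r.+2).+1 = i - r.+1 by lia.
    by have -> : i <= (r + q).+1 by lia.
  rewrite (leqNgt i) h2 /=; case: eqP => // ne; case: ifP => // h3; exfalso; lia.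
- by rewrite ltnSn.
Qed.

(** The last-passage recursion at one box. If the box is filled, the new length is one more than the
    diagonal one, and the pair of booleans is unchanged. If it is empty, the new length is the
    maximum of the two neighbours, which amounts to sorting the pair. *)
Lemma front_box F q r c : c < q ->
  box_step F (front F q r.+1 c.+1) (r.+1, c.+1) = front F q r.+1 c.
Proof.
move=> cq; rewrite /box_step /=.
have -> : r + c.+1 = r.+1 + c by lia.
set t := front F q r.+1 c.+1; set b := r.+1 + c; set d := q - c.+1.
have ed : q - c = d.+1 by rewrite /d; lia.
have e1 : t b = (maxchain F q r d.+1 == maxchain F q r d).
  by rewrite /t /front /b ltnNge leq_addr /= ltn_add2l ltnSn addKn ed.
have e2 : t b.+1 = (maxchain F q r.+1 d != maxchain F q r d).
  by rewrite /t /front /b -addnS ltnNge leq_addr /= ltnn eqxx.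
have f1 : front F q r.+1 c b = (maxchain F q r.+1 d.+1 != maxchain F q r d.+1).
  by rewrite /front /b ltnNge leq_addr /= ltnn eqxx ed.
have f2 : front F q r.+1 c b.+1 = (maxchain F q r.+1 d.+1 == maxchain F q r.+1 d).
  rewrite /front /b -addnS ltnNge leq_addr /= ltn_add2l ltnNge leqnSn /=.
  by rewrite eqn_add2l (gtn_eqF (ltnSn c)) leq_add2l cq addKn.
have f3 i : i != b -> i != b.+1 -> front F q r.+1 c i = t i.
  rewrite /t /front /b => n1 n2; case: ltnP => // h1.
  have -> : (i < r.+1 + c.+1) = (i < r.+1 + c) by lia.
  by case: ltnP => // h2; rewrite (negbTE n1) addnS (negbTE n2).
have := maxchain_row F q r d; have := maxchain_row F q r d.+1.
have := maxchain_col F q r d; have := maxchain_col F q r.+1 d.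
have [] := maxchain_step F q r d; have [] := maxchain_step F q r.+1 d.
have := maxchainSS F q r d; have -> : q - d = c.+1 by rewrite /d; lia.
move=> hm h1 h2 h3 h4 h5 h6 h7 h8; apply: functional_extensionality => i.
rewrite /bool_step e1 e2.
have [->|n1] := eqVneq i b.
  by rewrite f1; case: ifP => hF; rewrite ?hF in hm; [|case: ifP; rewrite ?swapl ?e2]; rewrite ?e1; lia.
have [->|n2] := eqVneq i b.+1.
  by rewrite f2; case: ifP => hF; rewrite ?hF in hm; [|case: ifP; rewrite ?swapr ?e1]; rewrite ?e2; lia.
by rewrite f3 //; case: ifP => // _; case: ifP => // _; rewrite swapE.
Qed.

Definition row_boxes (N r : nat) : seq (nat * nat) := [seq (r, c) | c <- rev (iota 1 (N - r))].

Lemma stairE N : stair N = flatten [seq row_boxes N r | r <- iota 1 N.-1].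
Proof. by []. Qed.

Lemma rev_iotaS m : rev (iota 1 m.+1) = m.+1 :: rev (iota 1 m).
Proof. by rewrite -[m.+1]addn1 iotaD rev_cat addn1. Qed.

Lemma front_rowboxes F q N r : q <= N - r.+1 ->
  foldl (box_step F) (front F q r.+1 q) (row_boxes N r.+1) = front F q r.+2 q.
Proof.
rewrite /row_boxes -front_row => hq.
have boxes c : c <= q -> foldl (box_step F) (front F q r.+1 c)
    [seq (r.+1, c) | c <- rev (iota 1 c)] = front F q r.+1 0.
  elim: c => // c IH hc; rewrite rev_iotaS [map _ _]/= [foldl _ _ _]/=.
  by rewrite front_box // IH // ltnW.
rewrite -(subnK hq); elim: (N - _ - q) => [|m IH]; first exact: boxes.
rewrite addSn rev_iotaS [map _ _]/= [foldl _ _ _]/= -[in RHS]IH; congr (foldl _ _ _).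
(* A box to the right of column [q] meets a false left entry and does nothing. *)
rewrite /box_step /bool_step; case: ifP => // _.
suff e : front F q r.+1 q (r.+1 + (m + q).+1).-1 = false by rewrite e.
rewrite /front ifF; last by lia.
rewrite ifF; last by lia.
case: eqP => [_|ne]; first by rewrite subnn !maxchain_r0.
by rewrite ifF //; lia.
Qed.

Lemma foldl_map_filter (S A B : Type) (g : S -> B -> S) (h : A -> B) (a : pred A) s l :
  foldl g s (map h (filter a l)) = foldl (fun s x => if a x then g s (h x) else s) s l.
Proof. by elim: l s => //= x l IH s; case: (a x) => /=; rewrite IH. Qed.

Definition letter (b : nat * nat) : nat := (b.1 + b.2).-1.

Definition skipped (N : nat) (F : nat -> nat -> bool) : seq (nat * nat) :=
  [seq b <- stair N | ~~ F b.1 b.2].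

Lemma dem_skipped N F q r (s : nat -> nat) rows : 0 < r ->
  (fun i => s i <= q) = front F q r q -> rows + r + q <= N.+1 ->
  let boxes := flatten [seq row_boxes N r | r <- iota r rows] in
  (fun i => dem s (map letter [seq b <- boxes | ~~ F b.1 b.2]) i <= q) = front F q (r + rows) q.
Proof.
move=> r0 e0 hN boxes; rewrite /dem foldl_map_filter.
have thr l t u : (fun i => t i <= q) = u ->
    (fun i => foldl (fun s x => if ~~ F x.1 x.2 then dem_step s (letter x) else s) t l i <= q)
    = foldl (box_step F) u l.
  elim: l t u => //= b l IH t u eu; apply: IH; rewrite /box_step -eu.
  by case: (F _ _) => //=; rewrite dem_threshold.
rewrite (thr _ _ _ e0) {thr e0 s} /boxes {boxes}.
elim: rows r r0 hN => [|rows IH] r r0 hN; first by rewrite addn0.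
rewrite [iota _ _]/= [map _ _]/= [flatten _]/= foldl_cat.
case: r r0 hN => // r _ hN; rewrite front_rowboxes; last by lia.
by rewrite IH ?addSnnS //; lia.
Qed.

Lemma rk_eq_below s t p q : (forall i, 0 < i <= p -> s i = t i) -> rk s p q = rk t p q.
Proof. by move=> h; rewrite /rk !big_nat; apply: eq_bigr => i hi; rewrite h. Qed.

Lemma dem_above s u p i : all (fun b => p < b) u -> i <= p -> dem s u i = s i.
Proof.
elim: u s => //= b u IH s /andP[hb hu] hi; rewrite IH // /dem_step.
by case: ifP => // _; rewrite swapE //; lia.
Qed.

(** Letters from rows below row [p] exceed [p] and leave the first [p] positions alone. For
    [i <= p], position [i] records whether row [i] lengthens the longest chain, and these increments
    telescope. *)
Lemma rk_skipped N F p : 0 < p < N ->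
  rk (dem id (map letter (skipped N F))) p (N - p) = maxchain F (N - p) p (N - p).
Proof.
move=> /andP[p0 pN]; rewrite /skipped stairE -(subnKC (_ : p <= N.-1)); last by lia.
rewrite iotaD map_cat flatten_cat filter_cat map_cat /dem foldl_cat -!/(dem _ _).
set u := map _ _; set v := map _ [seq b <- flatten [seq row_boxes N r | r <- iota (1 + p) _] | _].
have hv : all (fun b => p < b) v.
  apply/allP => b /mapP[[r c]]; rewrite mem_filter => /andP[_ /flattenP[bs /mapP[r' hr' ->]]].
  case/mapP=> c'; rewrite mem_rev mem_iota => hc [-> ->] ->; rewrite /letter /=.
  by move: hr'; rewrite mem_iota; lia.
rewrite (rk_eq_below (t := dem id u)); last by move=> i /andP[_ hi]; apply: dem_above hv hi.
have := @dem_skipped N F (N - p) 1 id p isT (esym (front_init F (N - p))) _.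
rewrite -/u => /(_ ltac:(lia)) hu.
have val i : 0 < i <= p -> (dem id u i <= N - p) =
    (maxchain F (N - p) i (N - p) != maxchain F (N - p) i.-1 (N - p)).
  move=> hi; rewrite [LHS](congr1 (fun f => f i) hu) /front ifT; last by lia.
  by rewrite eqn0Ngt; case/andP: hi => -> _.
have tele j : j <= p -> rk (dem id u) j (N - p) = maxchain F (N - p) j (N - p).
  elim: j => [|j IH] hj; first by rewrite rk0.
  rewrite rkS IH ?val //; last by lia.
  have := maxchain_row F (N - p) j (N - p); have [] := maxchain_step F (N - p) j (N - p).
  by rewrite /=; lia.
exact: tele.
Qed.

(** * Chains as sequences of boxes *)

Definition ne_lt (b b' : nat * nat) : bool := (b'.1 < b.1) && (b.2 < b'.2).

Definition chain_in F q r d (s : seq (nat * nat)) : bool :=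
  sorted ne_lt s && all (fun b => [&& F b.1 b.2, 0 < b.1 <= r & q - d < b.2 <= q]) s.

Lemma ne_lt_trans : transitive ne_lt.
Proof. by move=> b a c; rewrite /ne_lt; lia. Qed.

Lemma maxchain_ge F q r d s : d <= q -> chain_in F q r d s -> size s <= maxchain F q r d.
Proof.
elim: r d s => [|r IHr] d s dq.
  by case: s => [|b s] // /andP[_ /= /andP[/and3P[_ + _] _]]; lia.
elim: d dq s => [|d IHd] dq s.
  by case: s => [|b s] // /andP[_ /= /andP[/and3P[_ _ +] _]]; lia.
case: s => [|b s] //; rewrite maxchainSS => /andP[hs hb].
have hall : all (ne_lt b) s by exact: (order_path_min ne_lt_trans).
have [r1|r1] := eqVneq b.1 r.+1; last first.
  rewrite !leq_max; apply/orP; left; apply/orP; left; apply: IHr dq _.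
  apply/andP; split=> //; apply/allP => a ha; have := allP hb _ ha.
  move: ha; rewrite inE => /orP[/eqP->|/(allP hall)]; rewrite /ne_lt.
    by move=> /and3P[-> ? ->]; move: r1; lia.
  by move: hb => /= /andP[/and3P[_ ? _] _] ? /and3P[-> ? ->]; lia.
have [c1|c1] := eqVneq b.2 (q - d); last first.
  rewrite !leq_max; apply/orP; left; apply/orP; right; apply: IHd; first by lia.
  apply/andP; split=> //; apply/allP => a ha; have := allP hb _ ha.
  move: ha; rewrite inE => /orP[/eqP->|/(allP hall)]; rewrite /ne_lt.
    by move=> /and3P[-> -> ?] /=; move: c1; lia.
  by move: hb => /= /andP[/and3P[_ _ ?] _] ? /and3P[-> -> ?] /=; lia.
move: hb => /= /andP[/and3P[+ _ _] hb]; rewrite r1 c1 => ->.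
rewrite leq_max; apply/orP; right; rewrite addn1 ltnS; apply: IHr; first by lia.
apply/andP; split; first exact: path_sorted hs.
apply/allP => a ha; have := allP hb _ ha; have := allP hall _ ha; rewrite /ne_lt.
by move=> ? /and3P[-> ? ?] /=; lia.
Qed.

Lemma maxchain_ex F q r d : d <= q -> exists2 s, chain_in F q r d s & size s = maxchain F q r d.
Proof.
have wid r1 r2 d1 d2 s : r1 <= r2 -> d1 <= d2 -> chain_in F q r1 d1 s -> chain_in F q r2 d2 s.
  move=> hr hd /andP[h1 h2]; apply/andP; split=> //; apply: sub_all h2 => b.
  by move=> /and3P[-> ? ?] /=; lia.
elim: r d => [|r IHr] d dq; first by exists [::].
elim: d dq => [|d IHd] dq; first by exists [::].
rewrite maxchainSS.
have [s1 c1 <-] := IHr _ dq; have [s2 c2 <-] := IHd (ltnW dq); have [s3 c3 <-] := IHr _ (ltnW dq).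
have [h|h] := leqP (size s3 + F r.+1 (q - d)) (maxn (size s1) (size s2)).
  have [h'|h'] := leqP (size s1) (size s2).
    by exists s2 => //; apply: wid c2.
  by exists s1 => //; apply: wid c1.
case hF: (F _ _).
  exists ((r.+1, q - d) :: s3); last by rewrite addn1.
  case/andP: c3 => h1 h2; apply/andP; split.
    rewrite /= (path_sortedE ne_lt_trans) h1 andbT; apply: sub_all h2 => b /and3P[_ ? ?].
    by rewrite /ne_lt /=; lia.
  rewrite /= hF /=; apply/andP; split; first by lia.
  by apply: sub_all h2 => b /and3P[-> ? ?] /=; lia.
by exists s3; rewrite ?addn0 //; apply: wid c3.
Qed.

(** * Multitriangulations and reduced words *)

Lemma mem_stair N (b : nat * nat) : (b \in stair N) = [&& 0 < b.1, 0 < b.2 & b.1 + b.2 <= N].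
Proof.
apply/allpairsPdep/idP => [[r [c [hr]]]|].
  by rewrite mem_rev !mem_iota in hr * => hc ->/=; lia.
case: b => r c /= h; exists r, c; rewrite mem_rev !mem_iota; split=> //; lia.
Qed.

Definition box_lt (b b' : nat * nat) : bool := (b.1 < b'.1) || ((b.1 == b'.1) && (b'.2 < b.2)).

Lemma box_lt_trans : transitive box_lt.
Proof. by move=> b a c; rewrite /box_lt; lia. Qed.

Lemma box_lt_irr : irreflexive box_lt.
Proof. by move=> b; rewrite /box_lt; lia. Qed.

Lemma stair_sorted N : sorted box_lt (stair N).
Proof.
rewrite (sorted_pairwise box_lt_trans) stairE.
have row r : pairwise box_lt (row_boxes N r).
  rewrite /row_boxes pairwise_map -(sorted_pairwise (leT := _)); last first.
    by move=> b a c; rewrite /= /box_lt /=; lia.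
  rewrite rev_sorted; apply: sub_sorted (iota_ltn_sorted 1 _) => a b /=.
  by rewrite /box_lt /= eqxx orbC => ->.
elim: (iota 1 N.-1) (iota_ltn_sorted 1 N.-1) => //= r rs IH h.
rewrite pairwise_cat row (IH (path_sorted h)) !andbT.
apply/allrelP => b b' /mapP[c _ ->] /flattenP[bs /mapP[r' hr' ->] /mapP[c' _ ->]].
by rewrite /box_lt /= (allP (order_path_min ltn_trans h) _ hr').
Qed.

Lemma stair_uniq N : uniq (stair N).
Proof. exact: sorted_uniq box_lt_trans box_lt_irr _ (stair_sorted N). Qed.

Lemma box_of_inj n : injective (@box_of n).
Proof.
move=> [i j] [i' j'] [h1 h2]; congr pair; apply: val_inj => //=.
by have := ltn_ord j; have := ltn_ord j'; move: h1 => /=; lia.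
Qed.

Lemma box_of_stair n (e : vpair n) : (box_of e \in stair n) = (e.1 < e.2).
Proof. by rewrite mem_stair /box_of /=; have := ltn_ord e.2; lia. Qed.

Lemma stair_box_of n (b : nat * nat) : b \in stair n -> exists2 e : vpair n, b = box_of e & e.1 < e.2.
Proof.
case: b => r c; rewrite mem_stair /= => /and3P[r0 c0 rc].
have hc : c.-1 < n by lia.
have hr : n - r < n by lia.
by exists (Ordinal hc, Ordinal hr); rewrite /box_of /=; [congr pair|]; lia.
Qed.

Lemma mem_filling n (T : {set vpair n}) e : (box_of e \in filling T) = (e \in sides n :|: T).
Proof. by rewrite /filling mem_image //; exact: box_of_inj. Qed.

Lemma side_no_cross n (e f : vpair n) : e \in sides n -> f.1 < f.2 -> cross e f = false.
Proof.
rewrite inE /cross; have := ltn_ord f.2; have := ltn_ord e.2.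
by move: (nat_of_ord _) (nat_of_ord _) (nat_of_ord _) (nat_of_ord _) => a b c d; lia.
Qed.

Lemma sides_lt n (e : vpair n) : 2 < n -> e \in sides n -> e.1 < e.2.
Proof. rewrite inE; have := ltn_ord e.2; lia. Qed.

Definition fillingb n (T : {set vpair n}) r c := (r, c) \in filling T.

Lemma sorted_comparable (T : eqType) (r : rel T) s x y : transitive r -> sorted r s ->
  x \in s -> y \in s -> x != y -> r x y || r y x.
Proof.
move=> tr; elim: s => //= z s IH hs; have hz := order_path_min tr hs.
rewrite !inE => /orP[/eqP->|xs] /orP[/eqP->|ys]; rewrite ?eqxx //.
- by rewrite (allP hz _ ys).
- by rewrite (allP hz _ xs) orbT.
- exact: IH (path_sorted hs) xs ys.
Qed.

(** Boxes in the [p] by [n - p] corner are pairs with [e.1 < n - p <= e.2] in the numbering from 0,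
    so any first endpoint precedes any second one, and north-east comparable pairs cross. *)
Lemma crossing_freeP n k (T : {set vpair n}) : 0 < k -> 2 < n -> T \subset diagonals n ->
  reflect (forall p, 0 < p < n -> maxchain (fillingb T) (n - p) p (n - p) <= k) (crossing_free k T).
Proof.
move=> k0 n2 sT.
have ltT e : e \in sides n :|: T -> e.1 < e.2.
  rewrite inE => /orP[/sides_lt -> //|/(subsetP sT)]; rewrite !inE => /andP[] //.
apply: (iffP idP) => [cf p hp|h].
  rewrite leqNgt; apply/negP; have [s hs <-] := maxchain_ex (fillingb T) p (leqnn (n - p)).
  move=> hk; pose s' := take k.+1 s.
  have ss' : size s' = k.+1 by rewrite size_takel.
  have {hs} : chain_in (fillingb T) (n - p) p (n - p) s'.
    case/andP: hs => h1 h2; rewrite /chain_in take_sorted //=.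
    by apply/allP => b /mem_take /(allP h2).
  rewrite /chain_in subnn => /andP[cs' hs'].
  have [es ees hes] : exists2 es : seq (vpair n), s' = map (@box_of n) es &
      all [in sides n :|: T] es.
    elim: s' hs' {cs' ss'} => [|b s' IH] /=; first by exists [::].
    case/andP=> /and3P[hb _ _] /IH[es -> hes].
    move: hb; rewrite /fillingb -surjective_pairing => /imageP[e eT ->].
    by exists (e :: es) => //=; rewrite eT.
  have us' : uniq s' by apply: sorted_uniq cs'; [exact: ne_lt_trans|move=> b; rewrite /ne_lt; lia].
  have cr e f : e \in es -> f \in es -> e != f -> cross e f.
    move=> ein fin ne.
    have be : box_of e \in s' by rewrite ees map_f.
    have bf : box_of f \in s' by rewrite ees map_f.
    have := sorted_comparable ne_lt_trans cs' be bf; rewrite (inj_eq (@box_of_inj n)) => /(_ ne).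
    have /and3P[_ + +] := allP hs' _ be; have /and3P[_ + +] := allP hs' _ bf.
    rewrite /ne_lt /cross /box_of /=; have := ltn_ord e.2; have := ltn_ord f.2.
    by move: (nat_of_ord _) (nat_of_ord _) (nat_of_ord _) (nat_of_ord _) => a b c d; lia.
  have ues : uniq es by move: us'; rewrite ees => /map_uniq.
  have ses : size es = k.+1 by rewrite -ss' ees size_map.
  (* The chain has at least two members since [0 < k], so each of them crosses another; a side
     crosses nothing. *)
  have esT e : e \in es -> e \in T.
    move=> ein; have := allP hes _ ein; rewrite inE => /orP[eside|//].
    have [f fin ne] : exists2 f, f \in es & e != f.
      case: es ses ues ein {ees hes cr} => [|x [|y es]] //=; first by lia.
      rewrite inE => _ /andP[/norP[xy _] _] _.
      have [->|ex] := eqVneq e x; first by exists y; rewrite // !inE eqxx orbT.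
      by exists x; rewrite ?inE ?eqxx.
    have := cr _ _ ein fin ne; rewrite side_no_cross //; exact: ltT (allP hes _ fin).
  move/forallP: cf => /(_ [set e in es]) /implyP => hcf.
  have : mutually_crossing [set e in es].
    apply/forallP => e; apply/implyP; rewrite inE => ein; apply/forallP => f.
    by apply/implyP; rewrite inE => fin; apply/implyP; exact: cr.
  apply/negP; apply: hcf; apply/andP; split.
    by apply/subsetP => e; rewrite inE; exact: esT.
  by rewrite cardsE (card_uniqP ues) ses.
apply/forallP => S; apply/implyP => /andP[sST /eqP cS]; apply/negP => mc.
have crS e f : e \in S -> f \in S -> e != f -> cross e f.
  move=> eS fS ne; move/forallP: mc => /(_ e) /implyP/(_ eS) /forallP/(_ f) /implyP/(_ fS).
  by move/implyP; apply.
pose r (e f : vpair n) := e.1 <= f.1; pose es := sort r (enum S).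
have mes e : (e \in es) = (e \in S) by rewrite mem_sort mem_enum.
have ses : size es = k.+1 by rewrite size_sort -cardE.
have sortes : pairwise (fun e f => ne_lt (box_of e) (box_of f) && (f.1 < e.2)) es.
  have : pairwise (fun e f => r e f && (e != f)) es.
    rewrite pairwise_relI -uniq_pairwise sort_uniq enum_uniq andbT.
    rewrite -sorted_pairwise; last by move=> b a c; rewrite /r; exact: leq_trans.
    by apply: sort_sorted => e f; exact: leq_total.
  apply: (sub_in_pairwise (P := [in S])); last by apply/allP => e; rewrite mes.
  move=> e f eS fS /andP[ef ne]; have := crS _ _ eS fS ne; move: ef.
  rewrite /r /ne_lt /cross /box_of /=; have := ltn_ord e.2; have := ltn_ord f.2.
  by move: (nat_of_ord _) (nat_of_ord _) (nat_of_ord _) (nat_of_ord _) => a b c d; lia.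
case ee : es ses mes sortes => [//|e0 es'] /= [ses] mes /andP[h0 hs'].
have ltS e : e \in S -> e.1 < e.2.
  by move=> eS; apply: ltT; rewrite inE (subsetP sST _ eS) orbT.
have e0S : e0 \in S by rewrite -mes inE eqxx.
have lt0 := ltS _ e0S; have e0n := ltn_ord e0.2.
(* The corner is fixed by the member with the smallest first endpoint: all others start before
   [e0.2] and end after it, so [p = n - e0.2] fits. *)
have n0 : 0 < n - e0.2 < n by rewrite subn_gt0 e0n ltn_subrL (leq_ltn_trans _ lt0) // (leq_ltn_trans _ e0n).
have hp := h _ n0.
move: hp; rewrite subKn; last exact: ltnW.
apply/negP; rewrite -ltnNge.
apply: leq_trans (_ : size (map (@box_of n) (e0 :: es')) <= _); first by rewrite size_map /= ses.
apply: maxchain_ge => //; apply/andP; split.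
  rewrite (sorted_pairwise ne_lt_trans) pairwise_map /=; apply/andP; split.
    by apply: sub_all h0 => f /andP[].
  by apply: sub_pairwise hs' => e f /andP[].
apply/allP => b /mapP[e ein ->]; have eS : e \in S by rewrite -mes.
rewrite /fillingb -surjective_pairing mem_filling inE (subsetP sST _ eS) orbT subnn /=.
move: ein; rewrite inE => /orP[/eqP->|/(allP h0)]; first by rewrite subn_gt0 e0n leqnn lt0.
rewrite /ne_lt /=; have := ltn_ord e.2; move: e0n.
by move: (nat_of_ord _) (nat_of_ord _) (nat_of_ord _) (nat_of_ord _) => i1 i2 i3 i4; lia.
Qed.

Definition word n (T : {set vpair n}) : seq nat := map letter (skipped n (fillingb T)).

Lemma rk_monoq s p q q' : q <= q' -> rk s p q <= rk s p q'.
Proof.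
move=> h; elim: p => [|p IH]; rewrite ?rk0 // !rkS; apply: leq_add => //.
by case: (leqP (s p.+1) q) => // h1; rewrite (leq_trans h1 h).
Qed.

Lemma rk_addl s p p' q : rk s (p + p') q <= rk s p q + p'.
Proof. by elim: p' => [|p' IH]; rewrite ?addn0 // !addnS rkS; lia. Qed.

Lemma word_pos n (T : {set vpair n}) : 0 \notin word T.
Proof.
apply/negP => /mapP[[r c]]; rewrite mem_filter mem_stair /letter /= => /andP[_].
by case/and3P; lia.
Qed.

Lemma crossing_free_rk n k (T : {set vpair n}) : 0 < k -> 2 * k < n -> T \subset diagonals n ->
  crossing_free k T <-> rk_ge (wrev n k) (dem id (word T)).
Proof.
move=> k0 kn sT; have n2 : 2 < n by lia.
have e p : 0 < p < n -> rk (dem id (word T)) p (n - p) = maxchain (fillingb T) (n - p) p (n - p).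
  exact: rk_skipped.
split=> [/(crossing_freeP k0 n2 sT) h p q|h]; last first.
  apply/(crossing_freeP k0 n2 sT) => p hp; rewrite -e //; apply: leq_trans (h _ _) _.
  by rewrite rk_wrev //; lia.
have hmin p' q' : rk (dem id (word T)) p' q' <= minn p' q'.
  by rewrite -rk_id; apply: rk_dem_word; apply: word_pos.
rewrite rk_wrev //; have := hmin p q.
suff : rk (dem id (word T)) p q <= k + (p + q - n) by lia.
(* Below the antidiagonal [q] is raised to [n - p]; beyond it only [n - q] positions are kept, and
   each dropped position costs at most one. *)
have [hpq|hpq] := leqP (p + q) n.
  have [hp|hp] := boolP (0 < p < n); last by have := hmin p q; lia.
  have := h p hp; rewrite -e // => h'.
  by apply: leq_trans (rk_monoq _ _ (_ : q <= n - p)) _; lia.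
have [hq|hq] := boolP (0 < q < n); last by have := hmin p q; lia.
have hp : 0 < n - q < n by lia.
have := h _ hp; rewrite -e // subKn; last by lia.
have -> : p = (n - q) + (p - (n - q)) by lia.
have := rk_addl (dem id (word T)) (n - q) (p - (n - q)) q; lia.
Qed.

Lemma skipped_filling n (T : {set vpair n}) e :
  (box_of e \in skipped n (fillingb T)) = (e.1 < e.2) && (e \notin sides n :|: T).
Proof.
by rewrite mem_filter /fillingb -surjective_pairing mem_filling box_of_stair andbC.
Qed.

Lemma skipped_uniq n F : uniq (skipped n F).
Proof. by rewrite filter_uniq // stair_uniq. Qed.

Lemma skipped_complement n (s : seq (nat * nat)) : subseq s (stair n) ->
  (forall e : vpair n, e \in sides n -> box_of e \notin s) ->
  skipped n (fillingb [set e in diagonals n | box_of e \notin s]) = s.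
Proof.
move=> ss hs; set T := [set e in _ | _].
rewrite [RHS](subseq_uniqP (stair_uniq n) ss); apply: eq_in_filter => b.
case/stair_box_of=> e -> elt.
rewrite /fillingb -surjective_pairing mem_filling !inE.
have := hs e; rewrite inE; case: (_ || _) => /= [/(_ isT)/negbTE->//|_].
by rewrite elt /= negbK.
Qed.

(** Deleting letters from the word means adding their boxes to the filling; none of these is a side,
    so the chosen subword is the word of a larger set of diagonals. *)
Lemma subword_complement n k (T : {set vpair n}) : 0 < k -> 2 * k < n -> T \subset diagonals n ->
  crossing_free k T -> exists T' : {set vpair n}, [/\ T \subset T', T' \subset diagonals n &
    nil_act (Some id) (word T') = Some (wrev n k)].
Proof.
move=> k0 kn sT /(crossing_free_rk k0 kn sT) hrk.
have [m sm hm] := dem_subword (wrev_inj kn) (wrev0 n k) (word_pos T) hrk.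
pose s := mask m (skipped n (fillingb T)).
have sk : subseq s (skipped n (fillingb T)) by apply: mask_subseq.
have ss : subseq s (stair n) by apply: subseq_trans sk (filter_subseq _ _).
have hs e : e \in sides n -> box_of e \notin s.
  move=> es; apply/negP => /(mem_subseq sk); rewrite skipped_filling inE es andbF //.
exists [set e in diagonals n | box_of e \notin s]; split.
- apply/subsetP => e eT; rewrite inE (subsetP sT _ eT) /=.
  by apply/negP => /(mem_subseq sk); rewrite skipped_filling inE eT orbT andbF.
- by apply/subsetP => e; rewrite inE => /andP[].
- by rewrite /word skipped_complement // /s map_mask.
Qed.

Lemma word_crossing_free n k (T : {set vpair n}) : 0 < k -> 2 * k < n -> T \subset diagonals n ->
  nil_act (Some id) (word T) = Some (wrev n k) -> crossing_free k T.
Proof. by move=> k0 kn sT /nil_dem h; apply/(crossing_free_rk k0 kn sT); rewrite h. Qed.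

(** For the converse, a larger crossing-free set extends further to one whose word is also reduced
    for [wrev n k]. The two words have equal length, so the nested complements coincide. *)
Lemma ktriangulationP n k (T : {set vpair n}) : 0 < k -> 2 * k < n ->
  reflect (T \subset diagonals n /\ nil_act (Some id) (word T) = Some (wrev n k))
          (T \in ktriangulations n k).
Proof.
move=> k0 kn; rewrite inE; apply: (iffP maxsetP) => [[/andP[sT cT] mT]|[sT hT]].
  split=> //; have [T' [TT' sT' hT']] := subword_complement k0 kn sT cT.
  by rewrite -(mT T') ?sT' ?(word_crossing_free k0 kn sT' hT').
rewrite sT (word_crossing_free k0 kn sT hT); split=> // B /andP[sB cB] TB.
apply/eqP; rewrite eqEsubset TB andbT.
have [B' [BB' sB' hB']] := subword_complement k0 kn sB cB.
have TB' := subset_trans TB BB'.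
apply: subset_trans BB' _; apply/subsetP => e eB'.
have sub : {subset skipped n (fillingb B') <= skipped n (fillingb T)}.
  move=> b hb; have /stair_box_of[f eb _] : b \in stair n by move: hb; rewrite mem_filter => /andP[].
  move: hb; rewrite eb !skipped_filling !inE !negb_or => /and3P[-> -> hf] /=.
  by apply: contra hf => /(subsetP TB').
have sz : size (skipped n (fillingb T)) <= size (skipped n (fillingb B')).
  by rewrite -!(size_map letter) (size_wrev_word kn hT hB').
have [_ emem] := uniq_min_size (skipped_uniq _ _) sub sz.
have := emem (box_of e); rewrite !skipped_filling !inE eB' orbT andbF.
have := subsetP sB' _ eB'; rewrite !inE => /andP[/negbTE-> ->] /=.
by case: (e \in T).
Qed.

(** * Lattice paths *)

Lemma ypos_step l (D : lpath l) p : p < 2 * l -> ypos D p.+1 = ypos D p + nth false D p.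
Proof.
by move=> hp; rewrite /ypos (take_nth false) ?size_tuple // -cats1 count_cat /= addn0.
Qed.

Lemma xpos_step l (D : lpath l) p : p < 2 * l -> xpos D p.+1 = xpos D p + ~~ nth false D p.
Proof.
by move=> hp; rewrite /xpos (take_nth false) ?size_tuple // -cats1 count_cat /= addn0.
Qed.

Lemma xypos l (D : lpath l) p : p <= 2 * l -> xpos D p + ypos D p = p.
Proof.
elim: p => [|p IH] hp; first by rewrite /xpos /ypos take0.
by rewrite xpos_step // ypos_step //; have := IH (ltnW hp); case: (nth _ _ _) => /=; lia.
Qed.

Lemma ypos_mono l (D : lpath l) p p' : p <= p' -> p' <= 2 * l -> ypos D p <= ypos D p'.
Proof.
move=> h; rewrite -(subnKC h); elim: (p' - p) => [|d IH]; first by rewrite addn0.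
by rewrite addnS => hp; rewrite ypos_step //; have := IH (ltnW hp); lia.
Qed.

Lemma xpos_mono l (D : lpath l) p p' : p <= p' -> p' <= 2 * l -> xpos D p <= xpos D p'.
Proof.
move=> h; rewrite -(subnKC h); elim: (p' - p) => [|d IH]; first by rewrite addn0.
by rewrite addnS => hp; rewrite xpos_step //; have := IH (ltnW hp); lia.
Qed.

Lemma ypos_end l (D : lpath l) : ypos D (2 * l) = count id D.
Proof. by rewrite /ypos take_oversize // size_tuple. Qed.

Lemma nat_ivt (f : nat -> nat) P j : f 0 < j -> j <= f P ->
  (forall p, p < P -> f p.+1 <= (f p).+1) -> exists p, [/\ p < P, f p = j.-1 & f p.+1 = j].
Proof.
elim: P => [|P IH] h0 hP hs; first by lia.
have [h|h] := leqP j (f P).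
  have [p [hp e1 e2]] := IH h0 h (fun p hp => hs p (ltnW hp)).
  by exists p; split=> //; exact: ltnW.
by exists P; have := hs P (ltnSn _); split; lia.
Qed.

(** The time [m + b.2 - b.1] is the antidiagonal of the lower right corner of the box, and the box
    is above the path iff the path crosses there at or below that corner. *)
Lemma box_aboveE m (D : lpath m) (b : nat * nat) : b \in stair m ->
  box_above D b = (ypos D (m + b.2 - b.1) <= m - b.1).
Proof.
rewrite mem_stair => /and3P[i0 j0 ij].
have hP : m + b.2 - b.1 <= 2 * m by lia.
have := xypos D hP => hxy.
apply/existsP/idP => [[p /and3P[]]|hy].
  rewrite (tnth_nth false) => hp /eqP hx hy; have p2 := ltn_ord p.
  have := xypos D (ltnW p2); have := xpos_step D p2; rewrite hp => h1 h2.
  have hpP : p < m + b.2 - b.1 by lia.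
  by have := xpos_mono D hpP hP; lia.
have x0 : xpos D 0 < b.2 by rewrite /xpos take0.
have [|p hp|p [hp e1 e2]] := @nat_ivt (xpos D) (m + b.2 - b.1) b.2 x0; first by lia.
  by rewrite xpos_step; [case: (~~ _); lia|lia].
have p2 : p < 2 * m by lia.
exists (Ordinal p2); rewrite (tnth_nth false) /= e1 eqxx /=.
have := xpos_step D p2; rewrite e1 e2; case: (nth _ _ _) => /=; first by lia.
by have := ypos_mono D (ltnW hp) hP; lia.
Qed.

Lemma dyckP m (D : lpath m) : reflect (count id D = m /\ forall p, p <= 2 * m -> xpos D p <= ypos D p)
  (dyck D).
Proof.
apply: (iffP andP) => [[/eqP h /forallP hd]|[-> hd]]; split=> //.
  by move=> p hp; have := hd (Ordinal (hp : p < (2 * m).+1)).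
by apply/forallP => p; apply: hd; rewrite -ltnS.
Qed.

Lemma dyckE m (D : lpath m) : 0 < m -> dyck D =
  [&& count id D == m, head false D, ~~ last true D &
    [forall p : 'I_(2 * m), (0 < p < (2 * m).-1) ==> has (step_is_side D p) (stair m)]].
Proof.
move=> m0; have sD : size D = 2 * m by rewrite size_tuple.
have headE : head false D = nth false D 0 by rewrite nth0.
have lastE : last true D = nth false D (2 * m).-1.
  have -> : (2 * m).-1 = (size D).-1 by rewrite sD.
  by rewrite nth_last; case: (tval D) sD => //=; lia.
rewrite headE lastE; apply/idP/idP.
  case/dyckP=> hc hd; rewrite hc eqxx /=; apply/and3P; split.
  - have lt : 0 < 2 * m by lia.
    have := hd 1 lt; have := xypos D lt; have := ypos_step D lt.
    by rewrite [ypos D 0]/ypos take0 /=; case: (nth _ _ _) => //=; lia.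
  - have lt : (2 * m).-1 < 2 * m by lia.
    have := ypos_step D lt; have := hd _ (ltnW lt); have := xypos D (ltnW lt).
    rewrite prednK ?ypos_end ?hc; last by lia.
    by case: (nth _ _ _) => //=; lia.
  apply/forallP => p; apply/implyP => /andP[p0 p1]; have p2 := ltn_ord p.
  have hxy := xypos D (ltnW p2); have le := hd _ (ltnW p2); have le' := hd _ p2.
  have ym := ypos_mono D p2 (leqnn _); move: ym le'; rewrite ypos_end hc.
  rewrite ypos_step // xpos_step //.
  have := tnth_nth false D p; case: (nth _ _ _) => /= hD ym le'.
    (* A north step leaving the diagonal has no box of the staircase on its right, so the box on its
       left is used; likewise an east step at height [m] uses the box below it. *)
    have [e|ne] := eqVneq (xpos D p) (ypos D p).
      apply/hasP; exists (m - ypos D p, xpos D p); first by rewrite mem_stair /=; lia.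
      by rewrite /step_is_side /= hD; lia.
    apply/hasP; exists (m - ypos D p, (xpos D p).+1); first by rewrite mem_stair /=; lia.
    by rewrite /step_is_side /= hD eqxx; lia.
  have [e|ne] := eqVneq (ypos D p) m.
    apply/hasP; exists (1, (xpos D p).+1); first by rewrite mem_stair /=; lia.
    by rewrite /step_is_side /= hD eqxx; lia.
  apply/hasP; exists (m - ypos D p, (xpos D p).+1); first by rewrite mem_stair /=; lia.
  by rewrite /step_is_side /= hD eqxx; lia.
case/and4P=> /eqP hc h0 hl /forallP hs; apply/dyckP; split=> // p hp.
have [->|p0] := eqVneq p 0; first by rewrite /xpos take0.
have lt : (2 * m).-1 < 2 * m by lia.
have yl := ypos_step D lt; rewrite prednK ?ypos_end ?hc ?(negbTE hl) in yl; last by lia.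
have hxy := xypos D hp.
have [e|n1] := eqVneq p (2 * m); first by subst p; rewrite ypos_end hc in hxy *; lia.
have [e|n2] := eqVneq p (2 * m).-1; first by subst p; lia.
have p2 : p < 2 * m by lia.
have hp' : 0 < p < (2 * m).-1 by lia.
have /implyP/(_ hp') /hasP[[i j]] := hs (Ordinal p2).
rewrite mem_stair /step_is_side /=; case: ifP => _; lia.
Qed.

Lemma boundary_pathE m R s (D : lpath m) : 0 < m ->
  boundary_path R s D = dyck D && all (fun b => box_above D b == (R b < s)) (stair m).
Proof. by move=> m0; rewrite dyckE // /boundary_path -!andbA. Qed.

(** Where [D] is strictly lower than [D'], the box with its lower right corner at that point of [D]
    is above [D] but not above [D']. *)
Lemma dyck_weakly_above m (D D' : lpath m) : dyck D -> dyck D' ->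
  (forall b, b \in stair m -> box_above D b -> box_above D' b) -> weakly_above D D'.
Proof.
move=> /dyckP[_ hD] /dyckP[hc' _] h; apply/forallP => p.
have hp : p <= 2 * m by rewrite -ltnS.
rewrite leqNgt; apply/negP => lt.
have := xypos D hp; have := hD _ hp; have := xypos D' hp.
have := ypos_mono D' hp (leqnn _); rewrite ypos_end hc' => h1 h2 h3 h4.
have bs : (m - ypos D p, xpos D p) \in stair m by rewrite mem_stair /=; lia.
have := h _ bs; rewrite !box_aboveE //= (_ : m + xpos D p - (m - ypos D p) = p); last by lia.
by move=> /(_ ltac:(lia)); lia.
Qed.

Lemma weakly_above_box m (D D' : lpath m) (b : nat * nat) : weakly_above D D' -> b \in stair m ->
  box_above D b -> box_above D' b.
Proof.
move=> /forallP h bs; rewrite !box_aboveE //; apply: leq_trans.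
have hp : m + b.2 - b.1 < (2 * m).+1 by move: bs; rewrite mem_stair => /and3P[]; lia.
exact: (h (Ordinal hp)).
Qed.

Lemma weakly_above_anti m (D D' : lpath m) : weakly_above D D' -> weakly_above D' D -> D = D'.
Proof.
move=> /forallP h /forallP h'.
have e p : p <= 2 * m -> ypos D p = ypos D' p.
  move=> hp; have := h (Ordinal (hp : p < (2 * m).+1)); have := h' (Ordinal (hp : p < (2 * m).+1)).
  by rewrite /=; lia.
apply/val_inj/(@eq_from_nth _ false); rewrite ?size_tuple // => p hp.
have := e _ hp; rewrite !ypos_step // e; last exact: ltnW.
by move/addnI; do 2!case: (nth _ _ _).
Qed.

Lemma boundary_path_uniq m R s (D D' : lpath m) : 0 < m ->
  boundary_path R s D -> boundary_path R s D' -> D = D'.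
Proof.
move=> m0; rewrite !boundary_pathE // => /andP[d /allP h] /andP[d' /allP h'].
by apply: weakly_above_anti; apply: dyck_weakly_above => // b bs;
  rewrite (eqP (h _ bs)) (eqP (h' _ bs)).
Qed.

Lemma rpp_mono k m R i j i' j' : reverse_plane_partition k m R -> (i', j') \in stair m ->
  0 < i <= i' -> 0 < j <= j' -> R (i, j) <= R (i', j').
Proof.
case=> _ hr hc; rewrite mem_stair /= => /and3P[_ _ hm] /andP[i0 ii] /andP[j0 jj].
have col d : d <= i' - i -> R (i, j) <= R (i + d, j).
  elim: d => [|d IH] hd; rewrite ?addn0 // addnS; apply: leq_trans (IH (ltnW hd)) _.
  by apply: hc; rewrite mem_stair /=; lia.
have row d : d <= j' - j -> R (i', j) <= R (i', j + d).
  elim: d => [|d IH] hd; rewrite ?addn0 // addnS; apply: leq_trans (IH (ltnW hd)) _.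
  by apply: hr; rewrite mem_stair /=; lia.
have := col _ (leqnn _); rewrite subnKC // => /leq_trans; apply.
by have := row _ (leqnn _); rewrite subnKC.
Qed.

(* The path with the boxes [R < s] above it is traced greedily: at (x, y) it turns east as soon as the box at the right of the step north belongs above it. *)
Lemma boundary_path_ex k m R s : 0 < m -> reverse_plane_partition k m R ->
  exists D : lpath m, boundary_path R s D.
Proof.
move=> m0 rpp.
pose east (z : nat * nat) := (z.2 == m) || ((z.1 < z.2) && (R (m - z.2, z.1.+1) < s)).
pose pt p := iter p (fun z => if east z then (z.1.+1, z.2) else (z.1, z.2.+1)) (0, 0).
pose D : lpath m := [tuple ~~ east (pt p) | p < 2 * m].
have nD p : p < 2 * m -> nth false D p = ~~ east (pt p).
  by move=> hp; rewrite -[p]/(val (Ordinal hp)) -tnth_nth tnth_mktuple.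
have pos p : p <= 2 * m -> pt p = (xpos D p, ypos D p).
  elim: p => [|p IH] hp; first by rewrite /xpos /ypos take0.
  rewrite xpos_step // ypos_step // nD // negbK [pt p.+1]/= -/(pt p).
  by rewrite (IH (ltnW hp)) /=; case: (east _); rewrite ?addn0 ?addn1.
have bnd p : p <= 2 * m -> xpos D p <= ypos D p <= m.
  elim: p => [|p IH] hp; first by rewrite /xpos /ypos take0.
  have := xypos D (ltnW hp); have := IH (ltnW hp).
  rewrite xpos_step // ypos_step // nD // negbK /east (pos _ (ltnW hp)) /=.
  by case: eqP => [|/eqP] h /=; [lia|case: ltnP => /=; [case: (_ < s) => /=|]; lia].
have hD : dyck D.
  apply/dyckP; split; last by move=> p /bnd /andP[].
  by have := bnd _ (leqnn _); have := xypos D (leqnn _); rewrite ypos_end; lia.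
(* The boxes north-west of the current point have [R < s] and those south-east of it have [R >= s].
   At the antidiagonal of a box's lower right corner, one of the two parts applies to that box. *)
have inv p : p <= 2 * m -> forall i j, (i, j) \in stair m ->
    (j <= xpos D p -> ypos D p <= m - i -> R (i, j) < s) /\
    (xpos D p < j -> m - i < ypos D p -> s <= R (i, j)).
  elim: p => [|p IH] hp i j ij; have := ij; rewrite mem_stair => /and3P[];
    rewrite [_.1]/= [_.2]/= => i0 j0 hij.
    by rewrite /xpos /ypos take0 /=; split=> //; lia.
  have [h1 h2] := IH (ltnW hp) i j ij; have := bnd _ (ltnW hp).
  rewrite xpos_step // ypos_step // nD // negbK /east (pos _ (ltnW hp)) /=.
  set x := xpos D p in h1 h2 *; set y := ypos D p in h1 h2 *.
  move=> b1; have [ey|ney] := eqVneq y m => /=.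
    by split; [move=> _; lia|move=> ? ?; apply: h2; lia].
  have [xy|xy] := ltnP x y => /=; last first.
    split; [move=> ? ?; apply: h1; lia|move=> ? ?].
    have [lt|ge] := ltnP (m - i) y; [by apply: h2; lia|by lia].
  have [lt|ge] := ltnP (R (m - y, x.+1)) s => /=; rewrite ?addn0 ?addn1.
    split; last by move=> ? ?; apply: h2; lia.
    move=> hj hy; apply: leq_ltn_trans lt; apply: rpp_mono rpp _ _ _.
    - by rewrite mem_stair /=; lia.
    - by lia.
    - by lia.
  split; first by move=> ? ?; apply: h1; lia.
  move=> hj hy; have [lt|ge'] := ltnP (m - i) y; first by apply: h2; lia.
  apply: leq_trans ge _; apply: rpp_mono rpp ij _ _; lia.
suff key i j : (i, j) \in stair m -> box_above D (i, j) = (R (i, j) < s).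
  by exists D; rewrite boundary_pathE // hD; apply/allP => -[i j] bs; rewrite key.
move=> bs; rewrite box_aboveE // [_.1]/= [_.2]/=.
have := bs; rewrite mem_stair => /and3P[]; rewrite [_.1]/= [_.2]/= => i0 j0 ij.
have hP : m + j - i <= 2 * m by lia.
have hxy := xypos D hP; have [h1 h2] := inv _ hP i j bs.
apply/idP/idP => h; first by apply: h1; lia.
rewrite leqNgt; apply/negP => lt; have := h2 _ lt; lia.
Qed.

Lemma boundary_path_spec k m R s : 0 < m -> reverse_plane_partition k m R ->
  exists! D : lpath m, boundary_path R s D.
Proof.
move=> m0 /(boundary_path_ex s m0)[D hD]; exists D; split=> // D'.
exact: boundary_path_uniq hD.
Qed.

Lemma path_ofP k m R s : 0 < m -> reverse_plane_partition k m R -> boundary_path R s (path_of m R s).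
Proof.
move=> m0 /(boundary_path_ex s m0)[D hD]; rewrite /path_of; case: pickP => [//|/(_ D)].
by rewrite hD.
Qed.

Lemma path_of_fan k m R : 0 < m -> reverse_plane_partition k m R ->
  [tuple path_of m R s.+1 | s < k] \in fans k m.
Proof.
move=> m0 rpp; have hp s := path_ofP s m0 rpp.
rewrite inE; apply/andP; split; apply/forallP => s.
  by rewrite tnth_mktuple; have := hp s.+1; rewrite boundary_pathE // => /andP[].
apply/forallP => t; apply/implyP => st; rewrite !tnth_mktuple.
have := hp s.+1; have := hp t.+1; rewrite !boundary_pathE //.
move=> /andP[d1 /allP h1] /andP[d2 /allP h2]; apply: dyck_weakly_above => // b bs.
by rewrite (eqP (h1 _ bs)) (eqP (h2 _ bs)) => /leq_trans; apply.
Qed.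

(** The inverse of passing from [R] to paths. In a fan the paths having a given box above them form
    a final segment, so [find] counts the others, and returns [k] if there is no such path. *)
Definition rpp_of_fan k m (D : k.-tuple (lpath m)) (b : nat * nat) : nat :=
  find (fun p => box_above p b) D.

Lemma rpp_of_fanP k m (D : k.-tuple (lpath m)) : reverse_plane_partition k m (rpp_of_fan D).
Proof.
split=> [i j _|i j h h'|i j h h'].
- by rewrite -[leqRHS](size_tuple D) find_size.
- apply: sub_find => p; rewrite !box_aboveE //=; apply: leq_trans.
  by move: h; rewrite mem_stair /= => hij; apply: ypos_mono; lia.
- apply: sub_find => p; rewrite !box_aboveE //=.
  have -> : m + j - i = (m + j - i.+1).+1 by move: h'; rewrite mem_stair /=; lia.
  have lt : m + j - i.+1 < 2 * m by move: h'; rewrite mem_stair /=; lia.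
  by have := ypos_step p lt; move: h'; rewrite mem_stair /=; case: (nth _ _ _) => /=; lia.
Qed.

Lemma rpp_of_fan_path k m (D : k.-tuple (lpath m)) (s : 'I_k) : 0 < m -> D \in fans k m ->
  boundary_path (rpp_of_fan D) s.+1 (tnth D s).
Proof.
move=> m0; rewrite inE => /andP[/forallP hd /forallP hw].
rewrite boundary_pathE // hd; apply/allP => b bs; apply/eqP; rewrite /rpp_of_fan ltnS.
apply/idP/idP => h.
  rewrite leqNgt; apply/negP => /(before_find (tnth D s)).
  by rewrite -tnth_nth h.
have hk : find (fun p => box_above p b) D < k by exact: leq_ltn_trans h (ltn_ord s).
have := hw (Ordinal hk) => /forallP/(_ s)/implyP/(_ h) wa.
apply: (weakly_above_box wa bs); rewrite (tnth_nth (tnth D s)) /=.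
have := @nth_find _ (tnth D s) (fun p => box_above p b) D; apply.
by rewrite has_find size_tuple.
Qed.

(** * The bijection *)

Definition code (b : nat * nat) : nat * nat := (b.1, letter b).

Lemma biword_skipped n (T : {set vpair n}) :
  biword_of n (filling T) = map code (skipped n (fillingb T)).
Proof.
rewrite /biword_of /skipped; congr map; apply: eq_filter => b.
by rewrite /fillingb -surjective_pairing.
Qed.

Lemma word_biword n (T : {set vpair n}) : map snd (biword_of n (filling T)) = word T.
Proof. by rewrite biword_skipped -map_comp. Qed.

Lemma skipped_stair N F (b : nat * nat) : b \in skipped N F -> [/\ 0 < b.1, 0 < b.2 & b.1 + b.2 <= N].
Proof. by rewrite mem_filter mem_stair => /andP[_ /and3P]. Qed.

Lemma biword_all n (T : {set vpair n}) : all (fun p => 0 < p.1 <= p.2) (biword_of n (filling T)).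
Proof.
rewrite biword_skipped; apply/allP => p /mapP[[r c] /skipped_stair[]]; rewrite /code /letter /=.
by move=> r0 c0 _ -> /=; lia.
Qed.

Lemma biword_sorted n (T : {set vpair n}) : sorted read_lt (biword_of n (filling T)).
Proof.
rewrite biword_skipped sorted_map.
apply: (sub_in_sorted (P := fun b : nat * nat => 0 < b.1) (e := box_lt)).
- move=> [r c] [r' c']; rewrite !unfold_in /= /box_lt /read_lt /code /letter /=; lia.
- by apply/allP => b /skipped_stair[].
- by apply: sorted_filter (stair_sorted n); exact: box_lt_trans.
Qed.

Lemma recording_spec n k (T : {set vpair n}) : 0 < k -> 2 * k < n -> T \in ktriangulations n k ->
  [/\ (EG (biword_of n (filling T))).1 = rev_tab k.+1 (n - 2 * k).-1,
      has_stair_shape (n - 2 * k) (recording T) & flagged_tableau k (n - 2 * k) (recording T)].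
Proof.
move=> k0 kn /(ktriangulationP _ k0 kn)[sT hw]; set m := n - 2 * k; have m0 : 0 < m by lia.
have red : reduced (map snd (biword_of n (filling T))) by rewrite word_biword /reduced hw.
have ball := biword_all T.
have ball' : all (fun p => p.1 <= p.2) (biword_of n (filling T)).
  by apply: sub_all ball => p /andP[].
have [] := EG_inv (biword_sorted T) red ball'; rewrite -/(recording T).
set P := (EG _).1; set Q := recording T => tP nP sQ [cQ rQ] eQ pQ _.
have eP : P = rev_tab k.+1 m.-1.
  by apply: (tab_wrev kn tP); rewrite -nP word_biword.
have shape : has_stair_shape m Q by rewrite /has_stair_shape sQ eP size_rev_tab prednK.
have szQ i j : (i, j) \in stair m -> i.-1 < size (nth [::] Q j.-1).
  rewrite mem_stair /= => hij; rewrite -nth_sizes shape (nth_map 0) ?size_iota; last by lia.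
  by rewrite nth_iota; lia.
split=> //; split.
- move=> i j ij; have hi := szQ _ _ ij; rewrite /entry [_.1]/= [_.2]/=; apply/andP; split.
    have /pQ/mapP[p hp ->] := mem_nth 0 hi.
    by have /andP[] := allP ball _ hp.
  have := eQ _ _ hi; move: ij; rewrite mem_stair /= => hij.
  by rewrite eP nth_rev_tab; lia.
- move=> i j ij ij'; have := szQ _ _ ij'; move: ij; rewrite mem_stair /= => /and3P[_ j0 _].
  by rewrite -{1 2}(prednK j0) => hi; have := rQ _ _ hi; rewrite /entry /= prednK.
- move=> i j ij ij'; have := szQ _ _ ij'; move: ij; rewrite mem_stair /= => /and3P[i0 _ _] hi.
  have hi' : i.-1 < size (nth [::] Q j.-1) by rewrite (leq_ltn_trans _ hi) // leq_pred.
  rewrite /entry /=; have := sorted_ltn_nth ltn_trans 0 (cQ j.-1).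
  by move/(_ i.-1 i hi' hi); apply; rewrite prednK.
Qed.

Lemma flagged_rpp k m Q : flagged_tableau k m Q -> reverse_plane_partition k m (rpp_of Q).
Proof.
move=> [h1 h2 h3]; split=> i j ij.
- by have := h1 _ _ ij; rewrite /rpp_of /=; lia.
- by move=> ij'; have := h2 _ _ ij ij'; rewrite /rpp_of /=; lia.
- by move=> ij'; have := h3 _ _ ij ij'; rewrite /rpp_of /=; lia.
Qed.

Lemma flagged_ge k m Q i j : flagged_tableau k m Q -> (i, j) \in stair m -> i <= entry Q (i, j).
Proof.
move=> [h1 _ h3]; elim: i => // i IH ij.
have [i0|i0] := posnP i; first by subst i; have := h1 _ _ ij; lia.
have ij' : (i, j) \in stair m by move: ij; rewrite !mem_stair /=; lia.
exact: leq_ltn_trans (IH ij') (h3 _ _ ij' ij).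
Qed.

Lemma stair_shape_ext m Q Q' : has_stair_shape m Q -> has_stair_shape m Q' ->
  (forall b, b \in stair m -> entry Q b = entry Q' b) -> Q = Q'.
Proof.
move=> h h' e; have sz : map size Q = map size Q' by rewrite h h'.
have szQ : size Q = m.-1 by have := congr1 size h; rewrite !size_map size_iota.
have szQ' : size Q' = m.-1 by have := congr1 size h'; rewrite !size_map size_iota.
apply: (@eq_from_nth _ [::]); first by rewrite szQ szQ'.
move=> c hc; apply: (@eq_from_nth _ 0); first by rewrite -!nth_sizes sz.
move=> i; rewrite -nth_sizes h (nth_map 0) ?size_iota -?szQ // nth_iota -?szQ // => hi.
by apply: (e (i.+1, c.+1)); rewrite mem_stair /=; lia.
Qed.

Lemma Theta_inj n k : 0 < k -> 2 * k < n -> {in ktriangulations n k &, injective (@Theta n k)}.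
Proof.
move=> k0 kn T T' hT hT' eT; set m := n - 2 * k; have m0 : 0 < m by lia.
have [P1 sh fl] := recording_spec k0 kn hT; have [P2 sh' fl'] := recording_spec k0 kn hT'.
have rpp := flagged_rpp fl; have rpp' := flagged_rpp fl'.
(* The paths show [R b < s] for [0 < s <= k], and this determines [R b] because it is at most
   [k]. *)
have eR b : b \in stair m -> rpp_of (recording T) b = rpp_of (recording T') b.
  move=> bs.
  have eqs s : 0 < s <= k -> (rpp_of (recording T) b < s) = (rpp_of (recording T') b < s).
    case: s => // s /= sk; have := congr1 (fun D => tnth D (Ordinal sk)) eT.
    rewrite !tnth_mktuple /= => ep.
    have := path_ofP s.+1 m0 rpp; have := path_ofP s.+1 m0 rpp'; rewrite -/m in ep *; rewrite ep.
    rewrite !boundary_pathE // => /andP[_ /allP /(_ _ bs)/eqP <-] /andP[_ /allP /(_ _ bs)/eqP <-].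
    by [].
  have le : rpp_of (recording T) b <= k by case: b bs {eqs} => i j bs; case: rpp => h _ _; exact: h.
  have le' : rpp_of (recording T') b <= k by case: b bs {eqs le} => i j bs; case: rpp' => h _ _; exact: h.
  case: (ltngtP (rpp_of (recording T) b) (rpp_of (recording T') b)) => // h.
    have hk : 0 < rpp_of (recording T') b <= k by rewrite le' (leq_ltn_trans _ h).
    by have := eqs _ hk; rewrite h ltnn.
  have hk : 0 < rpp_of (recording T) b <= k by rewrite le (leq_ltn_trans _ h).
  by have := eqs _ hk; rewrite h ltnn.
have eQ : recording T = recording T'.
  apply: (stair_shape_ext sh sh') => -[i j] bs.
  have := eR _ bs; have := flagged_ge fl bs; have := flagged_ge fl' bs; rewrite /rpp_of /=; lia.
have /(ktriangulationP _ k0 kn)[sT hw] := hT; have /(ktriangulationP _ k0 kn)[sT' hw'] := hT'.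
have all_le S : all (fun p => p.1 <= p.2) (biword_of n (filling (S : {set vpair n}))).
  by apply: sub_all (biword_all S) => p /andP[].
have ew : biword_of n (filling T) = biword_of n (filling T').
  apply: EG_inj; rewrite ?biword_sorted ?word_biword ?all_le // /reduced ?hw ?hw' //.
  by rewrite [LHS]surjective_pairing [RHS]surjective_pairing P1 P2; congr pair.
have es : skipped n (fillingb T) = skipped n (fillingb T').
  move: ew; rewrite !biword_skipped => ew.
  have dec b : b \in stair n -> ((code b).1, ((code b).2.+1 - (code b).1)) = b.
    by case: b => r c; rewrite mem_stair /code /letter /= => /and3P[r0 c0 _]; congr pair; lia.
  have cK F : map (fun p => (p.1, p.2.+1 - p.1)) (map code (skipped n F)) = skipped n F.
    rewrite -map_comp -[RHS]map_id; apply/eq_in_map => b.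
    by rewrite mem_filter => /andP[_ /dec].
  by rewrite -cK ew cK.
apply/setP => e; have [ed|ed] := boolP (e \in diagonals n); last first.
  by rewrite (contraNF (subsetP sT e) ed) (contraNF (subsetP sT' e) ed).
have := skipped_filling T e; rewrite es skipped_filling.
move: ed; rewrite !inE => /andP[/negbTE-> ->] /=.
by case: (e \in T); case: (e \in T').
Qed.

Definition tableau_of m (R : nat * nat -> nat) : tableau :=
  [seq [seq R (i, j) + i | i <- iota 1 (m - j)] | j <- iota 1 m.-1].

Lemma size_tableau_of m R : has_stair_shape m (tableau_of m R).
Proof.
by rewrite /has_stair_shape -map_comp; apply: eq_map => j; rewrite /= size_map size_iota.
Qed.

Lemma nth_tableau_of m R c i : c + i.+1 < m ->
  nth 0 (nth [::] (tableau_of m R) c) i = R (i.+1, c.+1) + i.+1.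
Proof.
move=> h; rewrite (nth_map 0) ?size_iota; last by lia.
by rewrite nth_iota ?(nth_map 0) ?size_iota ?nth_iota //; lia.
Qed.

Lemma size_nth_tableau_of m R c : size (nth [::] (tableau_of m R) c) = m - c.+1.
Proof.
rewrite -nth_sizes size_tableau_of; have [h|h] := ltnP c m.-1.
  by rewrite (nth_map 0) ?size_iota // nth_iota.
by rewrite nth_default ?size_map ?size_iota //; lia.
Qed.

Lemma recording_surj n k R : 0 < k -> 2 * k < n -> reverse_plane_partition k (n - 2 * k) R ->
  exists2 T : {set vpair n}, T \in ktriangulations n k & recording T = tableau_of (n - 2 * k) R.
Proof.
move=> k0 kn rpp; set m := n - 2 * k; have m0 : 0 < m by lia.
set Q := tableau_of m R; set P := rev_tab k.+1 m.-1.
have [rk rr rc] := rpp.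
have hP : nil_act (Some id) (rd P ++ [::]) = Some (wrev n k) by rewrite cats0; exact: nil_act_wrev.
have sQ : map size Q = map size P by rewrite size_tableau_of size_rev_tab prednK.
have ssQ : semistd Q.
  split=> [c|c i]; last first.
    rewrite size_nth_tableau_of => hi; rewrite !nth_tableau_of ?leq_add2r; try lia.
    by apply: rr; rewrite mem_stair /=; lia.
  apply/(sortedP 0) => i; rewrite size_nth_tableau_of => hi.
  rewrite !nth_tableau_of; try lia.
  have : R (i.+1, c.+1) <= R (i.+2, c.+1) by apply: rc; rewrite mem_stair /=; lia.
  by rewrite /=; lia.
have fQ c i : i < size (nth [::] Q c) -> 0 < nth 0 (nth [::] Q c) i <= i.+1 + k.
  rewrite size_nth_tableau_of => hi; rewrite nth_tableau_of; last by lia.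
  have := rk i.+1 c.+1; rewrite mem_stair /= => /(_ ltac:(lia)); lia.
have [w [eW sW nW aW]] := EG_surj kn (tab_rev_tab _ _) hP sQ ssQ fQ.
have hw : nil_act (Some id) (map snd w) = Some (wrev n k) by rewrite nW -hP cats0.
pose s := [seq (p.1, p.2.+1 - p.1) | p <- w].
have codeK : map code s = w.
  rewrite -map_comp -[RHS]map_id; apply/eq_in_map => -[a b] /(allP aW) /=.
  by rewrite /code /letter /= => h; congr pair; lia.
have bs b : b \in s -> [&& 0 < b.1, 0 < b.2 & k < letter b < n - k].
  move=> hb; have : letter b \in map snd w by rewrite -codeK -map_comp map_f.
  move/(wrev_letters kn hw) => ->; rewrite andbT.
  case/mapP: hb => -[a x] /(allP aW) /= h ->; rewrite /=; lia.
have sstair b : b \in s -> b \in stair n.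
  by case: b => r c /bs; rewrite mem_stair /letter /=; lia.
have ss : sorted box_lt s.
  rewrite /s sorted_map; apply: (sub_in_sorted (P := fun p : nat * nat => 0 < p.1 <= p.2) _ _ sW) => //.
  move=> [a b] [a' b']; rewrite !unfold_in /= /box_lt /read_lt /=; lia.
have subs : subseq s (stair n).
  have -> : s = [seq b <- stair n | b \in s].
    apply: (irr_sorted_eq box_lt_trans box_lt_irr ss).
      by apply: sorted_filter (stair_sorted n); exact: box_lt_trans.
    by move=> b; rewrite mem_filter; case: (boolP (b \in s)) => // /sstair ->.
  exact: filter_subseq.
(* Sides give the letters [n - 1] and, for the closing side, 1; both lie outside the open range from
   [k] to [n - k] since [0 < k]. *)
have hs (e : vpair n) : e \in sides n -> box_of e \notin s.
  rewrite inE => he; apply/negP => /bs; rewrite /letter /box_of /=.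
  have := ltn_ord e.2; move: he; move: (nat_of_ord _) (nat_of_ord _) => a b; lia.
pose T := [set e in diagonals n | box_of e \notin s].
have eT : biword_of n (filling T) = w by rewrite biword_skipped skipped_complement.
exists T; last by rewrite /recording eT eW.
apply/(ktriangulationP _ k0 kn); split; last by rewrite -word_biword eT.
by apply/subsetP => e; rewrite inE => /andP[].
Qed.

Theorem theorem1p1 (n k : nat) (k_gt0 : 0 < k) (k2_lt_n : 2 * k < n) :
  (forall T : {set 'I_n * 'I_n}, T \in ktriangulations n k ->
     [/\ has_stair_shape (n - 2 * k) (recording T),
         flagged_tableau k (n - 2 * k) (recording T),
         reverse_plane_partition k (n - 2 * k) (rpp_of (recording T))
       & forall s : nat, 0 < s <= k ->
           exists! D : (2 * (n - 2 * k)).-tuple bool,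
             boundary_path (rpp_of (recording T)) s D]) /\
  {in ktriangulations n k &, injective (@Theta n k)} /\
  @Theta n k @: ktriangulations n k = fans k (n - 2 * k).
Proof.
have m0 : 0 < n - 2 * k by rewrite subn_gt0.
split=> [T hT|].
  have [_ sh fl] := recording_spec k_gt0 k2_lt_n hT; have rpp := flagged_rpp fl.
  by split=> // s _; exact: boundary_path_spec m0 rpp.
split; first exact: Theta_inj.
apply/setP => D; apply/imsetP/idP => [[T hT ->]|hD].
  by have [_ _ fl] := recording_spec k_gt0 k2_lt_n hT; exact: path_of_fan m0 (flagged_rpp fl).
have rpp := rpp_of_fanP D.
have [T hT eT] := recording_surj k_gt0 k2_lt_n rpp; exists T => //.
have [_ _ fl] := recording_spec k_gt0 k2_lt_n hT.
apply: eq_from_tnth => s; rewrite tnth_mktuple.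
(* The given path and the one selected by [path_of] bound the same boxes, as subtracting the row
   index from [tableau_of] returns the partition of the fan. *)
apply: (boundary_path_uniq m0 _ (path_ofP _ m0 (flagged_rpp fl))).
have := rpp_of_fan_path s m0 hD; rewrite !boundary_pathE // => /andP[-> /allP h] /=.
apply/allP => -[i j] bs; rewrite (eqP (h _ bs)) /rpp_of eT /entry /=.
have := bs; rewrite mem_stair /= => /and3P[i0 j0 ij].
by rewrite nth_tableau_of ?prednK ?addnK //; lia.
Qed.
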